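(* Let $n\ge1$, $q=2^n$, and let $G=\mathrm{PSL}(2,2^n)$ act on the $13$-subsets of $X=\mathrm{GF}(2^n)\cup\{\infty\}$. Put \[X_{1,n}=\tfrac{1}{6227020800}(q-2)(q-3)(q-4)(q-5)(q-6)(q-7)(q-8)(q-9)(q-10)(q-11),\] \[X_{2,n}=\tfrac{1}{46080}(q-2)(q-4)(q-6)(q-8)(q-10),\] \[X'_n=X_{1,n}-X_{2,n}+\tfrac{1}{1152}(q-2)(q-4)(q-8),\qquad Y_n=-\tfrac{1}{1944}(q-1)(q-4)(q-16).\] Then \[m_{1716}=\begin{cases} X'_n & \text{if } n\text{ is odd},\\ X'_n+Y_n & \text{if } n\equiv 2,4,8,14,16,22,26,28,32,34,38,44,46,52,56,58\pmod{60},\\ X'_n+Y_n+\frac{5}{11} & \text{if } n\equiv 10,20,40,50\pmod{60},\\ X'_n+Y_n+\frac{6}{13} & \text{if } n\equiv 6,12,18,24,36,42,48,54\pmod{60},\\ X'_n+Y_n+\frac{131}{143} & \text{if } n\equiv 0,30\pmod{60}\ (n>0). \end{cases}\]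
   Context: $\mathrm{PSL}(2,2^n)$ is the group of all maps $X\to X$, $x\mapsto\frac{ax+b}{cx+d}$ with $a,b,c,d\in\mathrm{GF}(2^n)$, $ad-bc\neq0$ (usual conventions for $\infty$). For a $13$-subset $B$ of $X$, $G_B=\{g\in G: g(B)=B\}$ and $G(B)=\{g(B):g\in G\}$. Each orbit $G(B)$ is a simple $3$-$(2^n+1,13,\lambda_B)$ design (every $3$-subset of $X$ lies in exactly $\lambda_B$ members of $G(B)$), with $\lambda_B=1716/|G_B|$. $m_\lambda$ denotes the number of $G$-orbits $G(B)$ of $13$-subsets with $\lambda_B=\lambda$; so $m_{1716}$ counts the orbits with $|G_B|=1$. *)

(* Defs.v *)
From HB Require Import structures.
From mathcomp Require Import all_boot all_order all_algebra all_fingroup.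
From mathcomp Require Import ring.

Set Implicit Arguments.
Unset Strict Implicit.
Unset Printing Implicit Defensive.

Import GRing.Theory.
Local Open Scope ring_scope.

Section Moebius.
Variable F : finFieldType.

(* The projective line F u {oo} is [option F], with [None] standing for oo. *)
Definition moebius (a b c d : F) (x : option F) : option F :=
  match x with
  | None => if c == 0 then None else Some (a / c)
  | Some t => if c * t + d == 0 then None else Some ((a * t + b) / (c * t + d))
  end.

Lemma moebius_comp (a b c d a' b' c' d' : F) (x : option F) :
    a * d - b * c != 0 -> a' * d' - b' * c' != 0 ->
  moebius a' b' c' d' (moebius a b c d x) =
  moebius (a' * a + b' * c) (a' * b + b' * d)
          (c' * a + d' * c) (c' * b + d' * d) x.
Proof.
move=> D D'; case: x => [t|] /=.
- have [z|nz] := eqVneq (c * t + d) 0 => /=.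
    have ew u v : (u * a + v * c) * t + (u * b + v * d) = u * (a * t + b).
      have -> : (u * a + v * c) * t + (u * b + v * d)
        = u * (a * t + b) + v * (c * t + d) by ring.
      by rewrite z mulr0 addr0.
    have nu : a * t + b != 0.
      apply: contraNneq D => u.
      have [c0|c0] := eqVneq c 0.
        by move: z; rewrite c0 mul0r add0r => ->; rewrite !mulr0 subr0.
      suff : c * (a * d - b * c) == 0 by rewrite mulf_eq0 (negPf c0).
      have -> : c * (a * d - b * c) = c * a * (c * t + d) - c * c * (a * t + b)
        by ring.
      by rewrite z u !mulr0 subr0.
    rewrite !ew mulf_eq0 (negPf nu) orbF; case: ifP => // /negbT c0.
    by congr Some; rewrite -mulf_div divff // mulr1.
  have ew u v : u * ((a * t + b) / (c * t + d)) + v =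
      ((u * a + v * c) * t + (u * b + v * d)) / (c * t + d) by field.
  rewrite !ew mulf_eq0 invr_eq0 (negPf nz) orbF; case: ifP => // /negbT w0.
  by congr Some; rewrite -mulf_div divff ?mulr1 // invr_neq0.
- have [c0|c0] := eqVneq c 0 => /=.
    have a0 : a != 0 by apply: contraNneq D => ->; rewrite c0 mulr0 mul0r subr0.
    rewrite c0 !mulr0 !addr0 mulf_eq0 (negPf a0) orbF; case: ifP => // /negbT w0.
    by congr Some; rewrite -mulf_div divff // mulr1.
  have ew u v : u * (a / c) + v = (u * a + v * c) / c by field.
  rewrite !ew mulf_eq0 invr_eq0 (negPf c0) orbF; case: ifP => // /negbT w0.
  by congr Some; rewrite -mulf_div divff ?mulr1 // invr_neq0.
Qed.

Lemma moebius_id x : moebius 1 0 0 1 x = x.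
Proof.
by case: x => [t|] /=; rewrite ?eqxx // mul0r add0r oner_eq0 divr1 mul1r addr0.
Qed.

(* Every invertible fractional linear map is a permutation, so nothing is lost
   by working in [{perm option F}] below. *)
Lemma moebius_inj (a b c d : F) :
  a * d - b * c != 0 -> injective (moebius a b c d).
Proof.
set D := a * d - b * c => nD.
have nD' : (d / D) * (a / D) - (- b / D) * (- c / D) != 0.
  have -> : (d / D) * (a / D) - (- b / D) * (- c / D) = D^-1.
    by rewrite /D; field.
  by rewrite invr_neq0.
apply: (@can_inj _ _ _ (moebius (d / D) (- b / D) (- c / D) (a / D))) => x.
rewrite moebius_comp // -[RHS]moebius_id.
by congr moebius; rewrite /D; field.
Qed.

(* In characteristic 2 every nonzero determinant is a square, so for
   #|F| = 2 ^ n the group of all these maps is PSL(2, 2 ^ n). *)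
Definition PSL2 : {set {perm option F}} :=
  [set g : {perm option F} | [exists a, exists b, exists c, exists d,
    (a * d - b * c != 0) && [forall x, g x == moebius a b c d x]]].

Lemma PSL2P (g : {perm option F}) :
  reflect (exists a b c d, a * d - b * c != 0 /\ g =1 moebius a b c d)
          (g \in PSL2).
Proof.
rewrite inE; apply: (iffP idP) => [|[a [b [c [d [D E]]]]]].
  case/existsP=> a /existsP[b /existsP[c /existsP[d /andP[D /forallP E]]]].
  by exists a, b, c, d; split=> // x; apply/eqP.
apply/existsP; exists a; apply/existsP; exists b; apply/existsP; exists c.
by apply/existsP; exists d; rewrite D; apply/forallP=> x; apply/eqP.
Qed.

Lemma PSL2_group_set : group_set PSL2.
Proof.
apply/group_setP; split.
  apply/PSL2P; exists 1, 0, 0, 1; split=> [|x].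
    by rewrite mulr1 mulr0 subr0 oner_neq0.
  by rewrite perm1 moebius_id.
move=> g h /PSL2P[a [b [c [d [D E]]]]] /PSL2P[a' [b' [c' [d' [D' E']]]]].
apply/PSL2P; exists (a' * a + b' * c), (a' * b + b' * d),
  (c' * a + d' * c), (c' * b + d' * d); split=> [|x].
  rewrite [X in X != 0](_ : _ = (a' * d' - b' * c') * (a * d - b * c)).
    by rewrite mulf_neq0.
  by ring.
by rewrite permM E E' moebius_comp.
Qed.

Canonical PSL2_group : {group {perm option F}} := group PSL2_group_set.

End Moebius.

(* t-(#|T|, k, lambda) design; simple, since the blocks form a set. *)
Definition is_design (T : finType) (t k lambda : nat) (D : {set {set T}}) :=
  [forall B in D, #|B| == k] &&
  [forall A : {set T}, (#|A| == t) ==>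
     (#|[set B in D | A \subset B]| == lambda)].

(* ['P^*] is the action of permutations on subsets of [option F] by images. *)
Definition orbits13 (F : finFieldType) : {set {set {set option F}}} :=
  [set orbit ('P^*) (PSL2 F) B | B in [set B : {set option F} | #|B| == 13]].

Definition m (F : finFieldType) (lambda : nat) : nat :=
  #|[set O in orbits13 F | is_design 3 13 lambda O]|.

(* [k%:R] with an explicit [%:R] keeps the large numeral k in decimal form. *)
Definition X1 (n : nat) : rat :=
  let q := 2 ^+ n in
  1 / 6227020800%:R *
  ((q - 2) * (q - 3) * (q - 4) * (q - 5) * (q - 6) * (q - 7) * (q - 8) *
   (q - 9) * (q - 10) * (q - 11)).

Definition X2 (n : nat) : rat :=
  let q := 2 ^+ n in
  1 / 46080%:R * ((q - 2) * (q - 4) * (q - 6) * (q - 8) * (q - 10)).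

Definition X' (n : nat) : rat :=
  let q := 2 ^+ n in
  X1 n - X2 n + 1 / 1152%:R * ((q - 2) * (q - 4) * (q - 8)).

Definition Y (n : nat) : rat :=
  let q := 2 ^+ n in
  - (1 / 1944%:R) * ((q - 1) * (q - 4) * (q - 16)).

(* Main.v *)
Require Import Defs.
From mathcomp Require Import all_boot all_order all_algebra all_fingroup.
From mathcomp Require Import all_solvable all_field.
From mathcomp Require Import zify ring.

(** Let q = 2^n and call a 13-subset of the projective line a block.  The
    group G is sharply 3-transitive of order q (q^2 - 1), so counting pairs
    (triple, image of B) shows that the orbit of a block B is a design with
    lambda = 1716 exactly when it has |G| members, that is, when the stabiliser
    H of B in G is trivial ([is_design1716E], [m1716_rigid]).  It remains to
    count the rigid blocks, those with trivial stabiliser.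

    A nonidentity element of G has at most two fixed points, so an element of
    prime order p in H satisfies p | 13 - f with f <= 2 fixed points in B:
    either p is 2 or 3 and f = 1, or p = 11 and f = 2, or p = 13 and f = 0
    ([prime_order_fix]).  No classification of the subgroups of G is needed:
    attach to B the set W of its points fixed by an element of order 2 or 3 of
    H.  If H is trivial then W is empty; if H has elements of order 11 then W
    consists of the 11 points that they move; if H has elements of order 13
    then W = B; in all remaining cases W is a single point
    ([card_centres23]).  Three facts carry this.  Given c in G with c^2 <> 1
    and a point x that c moves, some involution fixes x and inverts c
    ([inverting_involution]), so every point moved by an element of order 11 or
    13 lies in W.  A point fixed by an element of order 11 does not lie in W,
    because a nontrivial commutator in its stabiliser would be a translation,
    and a 12-set has 1, 2 or 4 translations, too few for an orbit of length 11
    ([order11_stab_point]).  Finally, a nontrivial group in which every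
    nonidentity element fixes exactly one point of B fixes a point of B
    ([common_fixed_point]).

    Summing |W| over all blocks gives
      (q + 1) w + #rigid = C(q + 1, 13) + 10 N11 + 12 N13,
    where N11 and N13 count the blocks whose stabiliser has elements of order
    11 and 13, and, by transitivity, w counts the blocks with the point at
    infinity in W ([census23]).  The numbers on the right come from similar
    double counts: the points fixed by elements of order 11 number 2 per block,
    and there are 12 elements of order 13 per block.  An element of order 13 is
    recognised by its invariant y = trace^2 / det, a root of
    y^6 + y^5 + y^4 + y + 1; this polynomial divides y^64 - y and is irreducible
    over the field of two elements, so it has 6 roots in GF(2^n) if 6 | n and
    none otherwise ([card_order13_moving_infty]).

    Removing the point at infinity turns w into the number of 12-subsets of
    GF(q) that are invariant under a translation or under an affine map of
    order 3.  The latter are rotations x -> a (x - z) + z with a^3 = 1, and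
    exist only for even n.  Sets invariant under a given group of affine maps
    are unions of orbits of equal size, hence are counted by binomial
    coefficients ([card_unions_of_classes]), and the number of translations
    (1, 2 or 4) and of rotation centres of a set controls the overcounting
    ([count_translators1], [count_translators2],
    [card_translated_or_rotated12]). *)

Set Implicit Arguments.
Unset Strict Implicit.
Unset Printing Implicit Defensive.

Import Order.TTheory GRing.Theory Num.Theory.

(** * Counting lemmas for finite sets and group actions *)

Section Classes.
Variables (T : finType) (S : {set T}) (cl : T -> {set T}) (k : nat).
Hypothesis clx : forall x, x \in S -> x \in cl x.
Hypothesis clS : forall x, x \in S -> cl x \subset S.
Hypothesis cleq : forall x y, x \in S -> y \in cl x -> cl y = cl x.
Hypothesis clk : forall x, x \in S -> #|cl x| = k.

Lemma classes_partition : (0 < k)%N -> partition (cl @: S) S.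
Proof.
move=> k0; apply/and3P; split.
- apply/eqP/setP=> y; apply/bigcupP/idP=> [[_ /imsetP[x xS ->] yx]|yS].
    exact: (subsetP (clS xS)).
  by exists (cl y); rewrite ?clx // imset_f.
- apply/trivIsetP=> _ _ /imsetP[x xS ->] /imsetP[y yS ->] ne.
  apply/pred0P=> z /=; apply: contraNF ne => /andP[zx zy].
  by rewrite -(cleq xS zx) (cleq yS zy).
- apply/imsetP=> -[x xS e]; move: (clk xS); rewrite -e cards0 => e0.
  by move: k0; rewrite -e0.
Qed.

Lemma card_classes : (0 < k)%N -> #|S| = (#|cl @: S| * k)%N.
Proof.
move=> /classes_partition PP; apply: card_uniform_partition PP.
by move=> _ /imsetP[x xS ->]; apply: clk.
Qed.

(** A subset closed under classes is determined by the set of classes that it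
    contains, so choosing one of size k j means choosing j of the |S| / k
    classes. *)
Lemma card_unions_of_classes (j : nat) : (0 < k)%N ->
  #|[set A : {set T} | [&& A \subset S, #|A| == (k * j)%N &
                           [forall x in A, cl x \subset A]]]| =
  'C(#|S| %/ k, j).
Proof.
move=> k0; pose P := cl @: S; have PP : partition P S := classes_partition k0.
have Pk : {in P, forall A : {set T}, #|A| = k}.
  by move=> _ /imsetP[x xS ->]; apply: clk.
rewrite (card_classes k0) mulnK // -cards_draws.
have subP (U : {set {set T}}) : U \subset P -> partition U (cover U).
  move=> UP; apply/and3P; split=> //.
    by apply: trivIsetS UP _; case/and3P: PP.
  by case/and3P: PP => _ _; apply: contra => /(subsetP UP).
have clU (U : {set {set T}}) x : U \subset P -> x \in cover U ->
    x \in S /\ cl x \in U.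
  move=> UP /bigcupP[X XU xX]; have /imsetP[y yS eX] := subsetP UP _ XU.
  have xS : x \in S by apply: (subsetP (clS yS)); rewrite -eX.
  by split=> //; rewrite (cleq yS) -?eX.
have coverK : {in [set U : {set {set T}} | U \subset P & #|U| == j],
    cancel (@cover T) (fun A => cl @: A)}.
  move=> U; rewrite inE => /andP[UP _]; apply/setP=> X.
  apply/imsetP/idP=> [[x xU ->]|XU]; first by case: (clU _ _ UP xU).
  have /imsetP[y yS eX] := subsetP UP _ XU.
  by exists y => //; apply/bigcupP; exists X; rewrite // eX clx.
rewrite -(card_in_imset (can_in_inj coverK)); apply: eq_card => A.
rewrite inE; apply/and3P/imsetP=> [[AS cA /forall_inP clA]|[U]]; last first.
  rewrite inE => /andP[UP /eqP cU] ->; split.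
  - by apply/subsetP=> x /(clU _ _ UP)[].
  - have Uk : {in U, forall A : {set T}, #|A| = k}.
      by move=> X /(subsetP UP); apply: Pk.
    by rewrite (card_uniform_partition Uk (subP _ UP)) cU mulnC.
  - apply/forall_inP=> x /(clU _ _ UP)[_ xU].
    by apply/subsetP=> y yx; apply/bigcupP; exists (cl x).
have UP : cl @: A \subset P by apply: imsetS.
have eA : A = cover (cl @: A).
  apply/setP=> x; apply/idP/bigcupP=> [xA|[_ /imsetP[y yA ->]]].
    by exists (cl x); rewrite ?imset_f ?clx // (subsetP AS).
  exact/subsetP/clA.
exists (cl @: A) => //; rewrite inE UP /=.
have Uk : {in cl @: A, forall A : {set T}, #|A| = k}.
  by move=> X /(subsetP UP); apply: Pk.
move: cA; rewrite {1}eA (card_uniform_partition Uk (subP _ UP)) mulnC.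
by rewrite eqn_pmul2l.
Qed.
End Classes.

(** With f x the number of nonidentity elements of H fixing x, the sum of f
    over S is |H| - 1, while an orbit O contributes |H| - |O|. An orbit with f
    > 0 has |O| <= |H| / 2, so two of them would contribute at least |H|.
    Hence there is just one, and |H| - |O| = |H| - 1 makes it a single point.
    *)
Lemma common_fixed_point (aT : finGroupType) (rT : finType)
    (to : {action aT &-> rT}) (H : {group aT}) (S : {set rT}) :
    [acts H, on S | to] -> H :!=: 1%g ->
    (forall h, h \in H^#%g -> #|'Fix_(S | to)[h]%g| = 1%N) ->
  exists2 x, x \in S & forall h, h \in H -> to x h = x.
Proof.
move=> actsH /trivgPn[h0 h0H h01] fix1.
pose f x := #|('C_H[x | to]^#)%g|.
have fE x : (f x).+1 = #|'C_H[x | to]%g| by rewrite [RHS](cardsD1 1%g) group1.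
have orbE x : (#|orbit to H x| * (f x).+1 = #|H|)%N.
  by rewrite fE card_orbit mulnC Lagrange ?subsetIl.
have sumE : (\sum_(x in S) f x = #|H|.-1)%N.
  rewrite (eq_bigr (fun x => \sum_(h in H^#%g | to x h == x) 1)%N); last first.
    move=> x _; rewrite sum1_card; apply: eq_card => h.
    rewrite [RHS]unfold_in /= !inE sub1set inE.
    by rewrite andbA.
  rewrite (exchange_big_dep (mem H^#%g)) /=; last by move=> x h _ /andP[].
  rewrite (eq_bigr (fun=> 1%N)).
    by rewrite sum1_card [in RHS](cardsD1 1%g) group1.
  move=> h hH; rewrite sum1_card -(fix1 h hH); apply: eq_card => x.
  rewrite in_setI unfold_in /= hH; congr (_ && _).
  by apply/eqP/afix1P.
have sumO x : (\sum_(y in orbit to H x) f y = #|H| - #|orbit to H x|)%N.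
  rewrite (eq_bigr (fun=> f x)) => [|y yx].
    by rewrite sum_nat_const -(orbE x) mulnS addKn.
  have ox : 0 < #|orbit to H x| by apply/card_gt0P; exists x; apply: orbit_refl.
  apply/eqP; rewrite -eqSS -(eqn_pmul2l ox) orbE.
  by rewrite -(orbit_eqP yx) orbE.
have orbS x : x \in S -> orbit to H x \subset S.
  by move=> xS; apply/subsetP=> y /orbitP[h hH <-]; rewrite (acts_act actsH).
have fgt x h : h \in H^#%g -> to x h = x -> (0 < f x)%N.
  rewrite !inE => /andP[h1 hH] hx; apply/card_gt0P; exists h.
  by apply/setD1P; split=> //; apply/setIP; split=> //; apply/astab1P.
have [x0 x0S hx0] : exists2 x, x \in S & to x h0 = x.
  have /eqP/cards1P[x ex] : #|'Fix_(S | to)[h0]%g| = 1%N by rewrite fix1 // !inE h01.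
  have : x \in 'Fix_(S | to)[h0]%g by rewrite ex inE.
  by case/setIP=> xS /afix1P; exists x.
have {hx0}f0 : (0 < f x0)%N by apply: (fgt _ h0); rewrite // !inE h01.
have le2 x : (0 < f x)%N -> (2 * #|orbit to H x| <= #|H|)%N.
  by rewrite -(orbE x); case: (f x) => // k _; rewrite mulnC leq_mul2l orbT.
have one y : y \in S -> (0 < f y)%N -> y \in orbit to H x0.
  move=> yS fy; apply/negPn/negP => ny.
  have dis : [disjoint orbit to H x0 & orbit to H y].
    apply/pred0P=> z /=; apply: contraNF ny => /andP[z0 zy].
    by rewrite -(orbit_eqP z0) (orbit_eqP zy) orbit_refl.
  have : (\sum_(z in orbit to H x0 :|: orbit to H y) f z <= #|H|.-1)%N.
    rewrite -sumE [leqRHS](big_setID (orbit to H x0 :|: orbit to H y)) /=.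
    by rewrite (setIidPr _) ?leq_addr // subUset !orbS.
  rewrite (eq_bigl (mem [predU orbit to H x0 & orbit to H y])) => [|z]; last by rewrite !inE.
  rewrite bigU //= !sumO.
  have h0' : (0 < #|H|)%N by apply: cardG_gt0.
  move: (le2 _ f0) (le2 _ fy) h0'; move: (#|orbit to H x0|) (#|orbit to H y|) (#|H|) => o1 o2 N.
  lia.
have only y : y \in S -> y \notin orbit to H x0 -> f y = 0%N.
  by move=> yS; apply: contraNeq; rewrite -lt0n; apply: one.
have : (#|orbit to H x0| <= 1)%N.
  have : (\sum_(z in orbit to H x0) f z = #|H|.-1)%N.
    rewrite -sumE [RHS](big_setID (orbit to H x0)) /= (setIidPr (orbS _ x0S)).
    rewrite [X in (_ + X)%N]big1 ?addn0 // => y /setDP[]; exact: only.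
  rewrite sumO; have h0' : (0 < #|H|)%N by apply: cardG_gt0.
  have := le2 _ f0; lia.
rewrite (cardD1 x0) orbit_refl ltnS leqn0 => /eqP/card0_eq o0.
exists x0 => // h hH; apply/eqP; have := o0 (to x0 h).
by rewrite !inE mem_orbit // andbT => /negbFE.
Qed.

(** * The projective line and its group *)

Section ProjectiveLine.
Variables (n : nat) (F : finFieldType).
Hypothesis cardF : #|F| = (2 ^ n)%N.
Local Notation G := (PSL2 F).
Local Notation X := (option F).
Implicit Types (a b c d x y : F) (g h : {perm X}) (B : {set X}).
Local Open Scope ring_scope.

Lemma addrr_pchar2F x : x + x = 0.
Proof. by have := addrr_pchar2 (card_finPcharP cardF isT) x. Qed.

Lemma oppr_pchar2F x : - x = x.
Proof. by apply/eqP; rewrite eq_sym -subr_eq0 opprK addrr_pchar2F. Qed.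

Lemma subr_pchar2F x y : x - y = x + y.
Proof. by rewrite oppr_pchar2F. Qed.

Lemma moebius_perm a b c d : a * d - b * c != 0 ->
  exists2 g, g \in G & g =1 moebius a b c d.
Proof.
move=> D; exists (perm (moebius_inj D)) => [|x]; last by rewrite permE.
by apply/PSL2P; exists a, b, c, d; split=> // x; rewrite permE.
Qed.

Lemma affine_perm a b : a != 0 ->
  exists2 g, g \in G & g None = None /\ forall x, g (Some x) = Some (a * x + b).
Proof.
move=> a0; have [|g gG gE] := @moebius_perm a b 0 1.
  by rewrite mulr1 mulr0 subr0.
exists g => //; split=> [|x]; rewrite gE /= ?eqxx //.
by rewrite mul0r add0r oner_eq0 divr1.
Qed.

Lemma affineP g : g \in G -> g None = None ->
  exists2 a, a != 0 & exists b, forall x, g (Some x) = Some (a * x + b).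
Proof.
case/PSL2P=> a [b [c [d [D E]]]]; rewrite E /=; case: eqP => // c0 _.
move: D; rewrite c0 mulr0 subr0 mulf_eq0 negb_or => /andP[a0 d0].
exists (a / d); first by rewrite mulf_neq0 ?invr_eq0.
exists (b / d) => x; rewrite E /= c0 mul0r add0r (negPf d0); congr Some.
by field.
Qed.

(** This and the next two lemmas give 3-transitivity by moving three points
    one after the other to infinity, 0 and 1. *)
Lemma to_infty (p : X) : exists2 g, g \in G & g p = None.
Proof.
case: p => [x|]; last by exists 1%g; rewrite ?group1 ?perm1.
have [|g gG gE] := @moebius_perm 0 1 1 (- x).
  by rewrite mul0r mulr1 sub0r oppr_eq0 oner_eq0.
by exists g => //; rewrite gE /= mul1r subrr eqxx.
Qed.

Lemma to_zero_infty (p1 p2 : X) : p1 != p2 ->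
  exists2 g, g \in G & g p1 = None /\ g p2 = Some 0.
Proof.
move=> ne; have [g gG g1] := to_infty p1.
have : g p2 != None by rewrite -g1 (inj_eq perm_inj) eq_sym.
case e: (g p2) => [x|] // _.
have [h hG [h1 h2]] := affine_perm (- x) (oner_neq0 F).
exists (g * h)%g; first exact: groupM.
by rewrite !permM g1 e h1 h2 mul1r subrr.
Qed.

Lemma to_one_zero_infty (p1 p2 p3 : X) : p1 != p2 -> p1 != p3 -> p2 != p3 ->
  exists2 g, g \in G & [/\ g p1 = None, g p2 = Some 0 & g p3 = Some 1].
Proof.
move=> n12 n13 n23; have [g gG [g1 g2]] := to_zero_infty n12.
have : g p3 != None by rewrite -g1 (inj_eq perm_inj) eq_sym.
have : g p3 != Some 0 by rewrite -g2 (inj_eq perm_inj) eq_sym.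
case e: (g p3) => [x|] // x0 _.
have {}x0 : x != 0 by apply: contraNneq x0 => ->.
have [|h hG [h1 h2]] := @affine_perm x^-1 0; first by rewrite invr_eq0.
exists (g * h)%g; first exact: groupM.
by rewrite !permM g1 g2 e h1 !h2 mulr0 mulVf // !addr0.
Qed.

(** After conjugation the fixed points are infinity, 0 and 1, and an affine
    map fixing 0 and 1 is the identity. *)
Lemma fix3_id g (p1 p2 p3 : X) : g \in G -> p1 != p2 -> p1 != p3 -> p2 != p3 ->
  g p1 = p1 -> g p2 = p2 -> g p3 = p3 -> g = 1%g.
Proof.
move=> gG n12 n13 n23 g1 g2 g3.
have [h hG [h1 h2 h3]] := to_one_zero_infty n12 n13 n23.
suff : (g ^ h)%g = 1%g by move=> e; apply: (@conjg_inj _ h); rewrite e conj1g.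
have hV (x y : X) : h x = y -> (h^-1)%g y = x by move=> <-; rewrite permK.
have kE (x y : X) : g x = x -> h x = y -> (g ^ h)%g y = y.
  by move=> gx hx; rewrite !permM (hV _ _ hx) gx hx.
have k1 := kE _ _ g1 h1; have k2 := kE _ _ g2 h2; have k3 := kE _ _ g3 h3.
have kG : (g ^ h)%g \in G by rewrite groupJ.
have [a a0 [b E]] := affineP kG k1.
move: k2 k3; rewrite !E mulr0 add0r mulr1 => -[b0] [].
rewrite b0 addr0 => a1; apply/permP=> -[x|]; rewrite perm1 ?k1 //.
by rewrite E a1 b0 mul1r addr0.
Qed.

Lemma mem_fixP g B (x : X) : (x \in 'Fix_(B | 'P)[g]%g) = (x \in B) && (g x == x).
Proof. by rewrite in_setI; congr (_ && _); apply/afix1P/eqP. Qed.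

Lemma card_fix_le2 g B : g \in G -> g != 1%g ->
  (#|'Fix_(B | 'P)[g]%g| <= 2)%N.
Proof.
move=> gG; apply: contraNT; rewrite -ltnNge => /card_gt2P[x [y [z [[]]]]].
rewrite !mem_fixP => /andP[_ /eqP gx] /andP[_ /eqP gy] /andP[_ /eqP gz].
by move=> [n12 n23 n31]; apply/eqP; apply: (fix3_id gG n12 _ n23); rewrite // eq_sym.
Qed.

Lemma PSL2_transitive : [transitive G, on [set: X] | 'P].
Proof.
apply/imsetP; exists None => //; apply/esym/setP=> p; rewrite inE; apply/orbitP.
have [g gG gp] := to_infty p; exists g^-1%g; first by rewrite groupV.
by rewrite /= apermE -gp permK.
Qed.

Lemma card_line : #|{: X}| = (2 ^ n).+1.
Proof. by rewrite card_option cardF. Qed.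

(** The projective line has q + 1 points, and the stabiliser of infinity is
    the group of q (q - 1) affine maps. *)
Lemma card_PSL2 : #|G| = ((2 ^ n).+1 * (2 ^ n * (2 ^ n).-1))%N.
Proof.
have sC : 'C_G[None | 'P]%g \subset G by apply: subsetIl.
rewrite -(Lagrange sC) mulnC -(card_orbit 'P) (atransP PSL2_transitive _) //.
rewrite cardsT card_line; congr (_ * _)%N.
have affE (u : F * F) : exists g : {perm X}, u.1 != 0 ->
    [/\ g \in G, g None = None & forall x, g (Some x) = Some (u.1 * x + u.2)].
  have [u0|] := eqVneq u.1 0; first by exists 1%g.
  by case/(affine_perm u.2) => g gG [g1 g2]; exists g.
have /fin_all_exists[f fP] := affE.
have finj : {in [set u : F * F | u.1 != 0] &, injective f}.
  move=> [a b] [a' b']; rewrite !inE /= => a0 a0' e.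
  have [_ _ /= f1] := fP (a, b) a0; have [_ _ /= f2] := fP (a', b') a0'.
  move: (f1 0) (f1 1); rewrite e !f2 !mulr0 !add0r !mulr1 => -[->].
  by move=> -[/addIr ->].
transitivity #|f @: [set u : F * F | u.1 != 0]|.
  apply: eq_card => g; rewrite inE (sameP astab1P eqP) /= apermE.
  apply/andP/imsetP=> [[gG /eqP g1]|[[a b]]]; last first.
    by rewrite inE => a0 ->; case: (fP _ a0) => fG f1 _; rewrite fG f1.
  have [a a0 [b E]] := affineP gG g1.
  exists (a, b); rewrite ?inE //; have [_ f1 f2] := fP (a, b) a0.
  by apply/permP=> -[x|]; rewrite ?E ?f2 ?f1.
rewrite (card_in_imset finj).
have -> : [set u : F * F | u.1 != 0] = setX [set~ 0] [set: F].
  by apply/setP=> u; rewrite !inE andbT.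
by rewrite cardsX cardsT cardsC1 cardF mulnC.
Qed.
End ProjectiveLine.

(** * Orbits as designs *)

Section Designs.
Variables (n : nat) (F : finFieldType).
Hypothesis cardF : #|F| = (2 ^ n)%N.
Local Notation G := (PSL2 F).
Local Notation X := (option F).
Implicit Types (g h : {perm X}) (A B : {set X}) (O : {set {set X}}).
Local Open Scope nat_scope.

Definition stab (F : finFieldType) (B : {set option F}) :=
  ('N_(PSL2 F)(B | 'P))%g.

Lemma setactPE B g : ('P^*)%act B g = [set g x | x in B].
Proof. by apply: eq_imset => x; rewrite /= apermE. Qed.

Lemma stabP B g :
  reflect (g \in G /\ forall x, (g x \in B) = (x \in B)) (g \in stab B).
Proof.
have aP := @astabsP _ _ ('P)%act B g.
apply: (iffP setIP) => -[gG gB]; split=> //; last exact/aP.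
by move=> x; move/aP: gB => /(_ x).
Qed.

Lemma card_stab B :
  #|stab B| * #|orbit ('P^*) G B| = #|G|.
Proof.
rewrite card_orbit -(Lagrange (subsetIl G ('C[B | 'P^*])%g)).
by rewrite /stab /= !astab1_set.
Qed.

(** Double count of the pairs (triple, block containing it); 286 = C(13, 3).
    *)
Lemma sum_card_blocks_through O : (forall B, B \in O -> #|B| = 13) ->
  \sum_(A : {set X} | #|A| == 3) #|[set B in O | A \subset B]| = 286 * #|O|.
Proof.
move=> O13; under eq_bigr do rewrite -sum1_card.
rewrite (exchange_big_dep (mem O)) /=; last by move=> A B _; rewrite inE => /andP[].
rewrite (eq_bigr (fun=> 286)); first by rewrite sum_nat_const mulnC.
move=> B BO; rewrite sum1_card.
transitivity #|[set A : {set X} | A \subset B & #|A| == 3]|.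
  by apply: eq_card => A; rewrite !inE unfold_in /= inE BO andbC.
by rewrite cards_draws O13.
Qed.

(** Every triple can be moved to the triple of infinity, 0 and 1. *)
Lemma homogeneous3 A A' : #|A| = 3 -> #|A'| = 3 ->
  exists2 g, g \in G & [set g x | x in A] = A'.
Proof.
have std (C : {set X}) : #|C| = 3 -> exists2 g, g \in G &
    [set g x | x in C] = [set None; Some 0%R; Some 1%R].
  move=> C3; have /card_gt2P[x [y [z [[xC yC zC] [nxy nyz nzx]]]]] : 2 < #|C|.
    by rewrite C3.
  have {nzx} nxz : x != z by rewrite eq_sym.
  have -> : C = [set x; y; z].
    apply/esym/eqP; rewrite eqEcard C3 !subUset !sub1set xC yC zC.
    by rewrite setUC cardsU1 cards2 !inE nxy (eq_sym z) (negPf nxz) (eq_sym z) (negPf nyz).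
  have [g gG [gx gy gz]] := to_one_zero_infty nxy nxz nyz.
  by exists g => //; rewrite !imsetU !imset_set1 gx gy gz.
move=> /std[g gG gE] /std[h hG hE]; exists (g * h^-1)%g.
  by rewrite groupMl // groupV.
transitivity [set (h^-1)%g x | x in [set g x | x in A]].
  by rewrite -imset_comp; apply: eq_imset => x; rewrite /= permM.
rewrite gE -hE -imset_comp -[RHS]imset_id; apply: eq_imset => x /=.
by rewrite permK.
Qed.

Lemma orbit_in O : O \in orbits13 F ->
  exists2 B : {set X}, #|B| = 13 & O = orbit ('P^*) G B.
Proof. by case/imsetP=> B; rewrite inE => /eqP cB ->; exists B. Qed.

Lemma card_blocks_through B A A' : #|A| = 3 -> #|A'| = 3 ->
  #|[set C in orbit ('P^*) G B | A \subset C]| =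
  #|[set C in orbit ('P^*) G B | A' \subset C]|.
Proof.
suff le (C C' : {set X}) : #|C| = 3 -> #|C'| = 3 ->
    #|[set D in orbit ('P^*) G B | C \subset D]| <=
    #|[set D in orbit ('P^*) G B | C' \subset D]|.
  by move=> A3 A'3; apply/eqP; rewrite eqn_leq !le.
move=> C3 C'3; have [g gG <-] := homogeneous3 C3 C'3.
rewrite -(card_imset _ (act_inj ('P^*) g)); apply: subset_leq_card.
apply/subsetP=> _ /imsetP[D + ->]; rewrite !inE => /andP[DO CD].
by rewrite orbit_actr // DO /= setactPE imsetS.
Qed.

(** By homogeneity every triple lies in the same number k of blocks of the
    orbit O, and double counting gives C(q + 1, 3) k = 286 |O|. Since |G| = 6
    C(q + 1, 3) and 1716 = 6 * 286, the value k = 1716 means |O| = |G|. *)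
Lemma is_design1716E O : O \in orbits13 F ->
  is_design 3 13 1716 O = (#|O| == #|G|).
Proof.
case/orbit_in=> B B13 ->; set O' := orbit _ _ _.
have O13 C : C \in O' -> #|C| = 13.
  by case/orbitP=> g gG <-; rewrite card_setact.
have sumE := sum_card_blocks_through O13.
have cA : #|[set A : {set X} | #|A| == 3]| = 'C((2 ^ n).+1, 3).
  by rewrite card_draws (card_line cardF).
have cG : #|G| = 6 * 'C((2 ^ n).+1, 3).
  by rewrite (card_PSL2 cardF) [RHS]mulnC (_ : 6 = 3`!) // bin_ffact !ffactnS ffactn0 muln1.
have sumc k : (forall A : {set X}, #|A| = 3 -> #|[set C in O' | A \subset C]| = k) ->
    'C((2 ^ n).+1, 3) * k = 286 * #|O'|.
  move=> E; rewrite -sumE (eq_bigr (fun=> k)) => [|A /eqP]; last exact: E.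
  by rewrite sum_nat_const -cA; congr (_ * _); apply: eq_card => A; rewrite inE.
apply/idP/eqP=> [/andP[_ /forallP D]|cO].
  have /sumc : forall A : {set X}, #|A| = 3 -> #|[set C in O' | A \subset C]| = 1716.
    by move=> A A3; apply/eqP; move: (D A); rewrite A3.
  rewrite cG; move: (#|O'|) ('C(_, _)) => u v; lia.
apply/andP; split; first by apply/forall_inP=> C /O13 ->.
apply/forall_inP=> A /eqP A3.
have /sumc : forall A' : {set X}, #|A'| = 3 ->
    #|[set C in O' | A' \subset C]| = #|[set C in O' | A \subset C]|.
  by move=> A' A'3; apply: card_blocks_through.
have : 0 < 'C((2 ^ n).+1, 3).
  by rewrite -cA; apply/card_gt0P; exists A; rewrite inE A3.
rewrite cO cG; move: ('C(_, _)) (#|[set C in O' | _]|) => v u v0.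
rewrite mulnA [RHS]mulnC => /eqP; rewrite eqn_pmul2l // => /eqP ->.
Qed.

Definition rigid13 (F : finFieldType) : {set {set option F}} :=
  [set B : {set option F} | (#|B| == 13) && (stab B == [1])%g].

(** The orbits counted by the left side partition the rigid blocks into parts
    of size |G|. *)
Lemma m1716_rigid : m F 1716 * #|G| = #|rigid13 F|.
Proof.
have rigE B : B \in rigid13 F = (#|B| == 13) && (#|orbit ('P^*) G B| == #|G|).
  rewrite inE; congr (_ && _); rewrite trivg_card1 -(card_stab B).
  have : 0 < #|orbit ('P^*) G B| by apply/card_gt0P; exists B; apply: orbit_refl.
  by move: (#|orbit _ _ _|) (#|stab B|) => u v u0; rewrite -{1}[u]mul1n eqn_pmul2r // eq_sym.
have actsG : [acts G, on rigid13 F | 'P^*].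
  apply/actsP=> g gG B; rewrite !rigE card_setact.
  by rewrite (orbit_act ('P^*) B gG).
rewrite (@card_uniform_partition _ #|G| _ _ _ (orbit_partition actsG)) => [|O].
  congr (_ * _)%N; apply: eq_card => O; rewrite inE.
  apply/andP/imsetP=> [[O13 +]|[B + ->]].
    rewrite is_design1716E //; case/orbit_in: O13 => B B13 -> cO.
    by exists B => //; rewrite rigE B13.
  rewrite rigE => /andP[B13 cO].
  have BO : orbit ('P^*) G B \in orbits13 F by apply: imset_f; rewrite inE.
  by rewrite is_design1716E.
by case/imsetP=> B + ->; rewrite rigE => /andP[_ /eqP].
Qed.
End Designs.

(** * Elements stabilising a block *)

Canonical stab_group (F : finFieldType) (B : {set option F}) :=
  Eval hnf in [group of stab B].

Section Stabilisers.
Variables (n : nat) (F : finFieldType).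
Hypothesis cardF : #|F| = (2 ^ n)%N.
Local Notation G := (PSL2 F).
Local Notation X := (option F).
Implicit Types (c g h s : {perm X}) (B : {set X}).
Local Open Scope nat_scope.

Lemma stab_acts B : [acts stab B, on B | 'P].
Proof. by apply: subsetIr. Qed.

Lemma stab_sub B : stab B \subset G.
Proof. by apply: subsetIl. Qed.

(** The number of fixed points in B is congruent to 13 modulo the order and at
    most 2, so the order divides 13, 12 or 11. *)
Lemma prime_order_fix B c : #|B| = 13 -> c \in stab B -> prime #[c]%g ->
  [|| ((#[c]%g == 2) || (#[c]%g == 3)) && (#|'Fix_(B | 'P)[c]%g| == 1),
      (#[c]%g == 11) && (#|'Fix_(B | 'P)[c]%g| == 2) |
      (#[c]%g == 13) && (#|'Fix_(B | 'P)[c]%g| == 0)].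
Proof.
move=> B13 cB pc; have [cG _] := stabP B c cB.
have le2 : #|'Fix_(B | 'P)[c]%g| <= 2.
  apply: card_fix_le2 => //.
  by apply: contraTneq pc => ->; rewrite order1.
have pgc : (#[c].-group <[c]>)%g by rewrite /pgroup -orderE pnat_id.
have acc : [acts <[c]>%g, on B | 'P].
  by rewrite cycle_subG; apply: (subsetP (stab_acts B)).
have := pgroup_fix_mod pgc acc; rewrite afix_cycle ?inE // B13.
move: le2 pc; case: #|_| => [|[|[|//]]] _ pc /eqP e.
- have : #[c]%g %| 13 by rewrite /dvdn (eqP e) mod0n.
  by rewrite dvdn_prime2 // => ->; rewrite ?orbT.
- have : #[c]%g %| 2 ^ 2 * 3.
    by have := eqn_mod_dvd #[c]%g (isT : 1 <= 13); rewrite e => /esym.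
  rewrite Euclid_dvdM // Euclid_dvdX // andbT !dvdn_prime2 // => ->.
  by rewrite ?orbT.
- have : #[c]%g %| 11.
    by have := eqn_mod_dvd #[c]%g (isT : 2 <= 13); rewrite e => /esym.
  by rewrite dvdn_prime2 // => ->; rewrite ?orbT.
Qed.

(** In characteristic 2 a matrix of trace zero has the form (a b; e a), and
    its square is scalar. *)
Lemma traceless_invol g (a b e : F) : (a * a - b * e != 0)%R ->
  g =1 moebius a b e a -> (g * g = 1)%g.
Proof.
move=> D gE; apply/permP=> x; rewrite permM perm1 !gE moebius_comp //.
rewrite (mulrC b a) (mulrC e a) !(addrr_pchar2F cardF) (mulrC e b).
rewrite (subr_pchar2F cardF) in D; rewrite (addrC (b * e)%R).
case: x => [x|] /=; last by rewrite eqxx.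
by rewrite mul0r add0r (negPf D) addr0 mulrAC divff // mul1r.
Qed.

(** Move x to infinity. Involutions fixing infinity are the translations, and
    the translation by t conjugates c to its inverse exactly when their
    product has trace zero. For c with matrix (a b; e d), where e <> 0 as c
    moves infinity, this gives t = (a + d) / e, which is nonzero because c is
    not an involution. *)
Lemma inverting_involution c (x : X) : c \in G -> (c * c != 1)%g -> c x != x ->
  exists2 s, s \in G & [/\ #[s]%g = 2, s x = x & (s * c * (s * c) = 1)%g].
Proof.
move=> cG c2 cx; have [g gG gx] := to_infty x.
suff [s sG [s2 sx sc]] : exists2 s, s \in G &
    [/\ #[s]%g = 2, s None = None & (s * (c ^ g) * (s * (c ^ g)) = 1)%g].
  exists (s ^ g^-1)%g; first by rewrite groupJr ?groupV.
  split; first by rewrite orderJ.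
    rewrite conjgE invgK !permM gx sx -gx permK //.
  have -> : (s ^ g^-1 * c = (s * (c ^ g)) ^ g^-1)%g by rewrite conjMg conjgK.
  by rewrite -conjMg sc conj1g.
have: (c ^ g * c ^ g != 1)%g by rewrite -conjMg conjg_eq1.
have: (c ^ g)%g None != None.
  have gV : (g^-1)%g None = x by rewrite -gx permK.
  by rewrite conjgE !permM gV -gx (inj_eq perm_inj).
have: (c ^ g)%g \in G by rewrite groupJ.
move: (c ^ g)%g => {}c {}cG {}cx {}c2.
have /PSL2P[a [b [e [d [D E]]]]] := cG.
have e0 : e != 0%R by move: cx; rewrite E /=; case: ifP.
pose t := ((a + d) / e)%R.
have t0 : t != 0%R.
  apply: contraNneq c2 => /eqP; rewrite mulf_eq0 invr_eq0 (negPf e0) orbF.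
  rewrite -(subr_pchar2F cardF) subr_eq0 => /eqP ad; rewrite -ad in D E.
  by rewrite (traceless_invol D E).
have [s sG [s1 s2]] := affine_perm t (oner_neq0 F).
have ss : (s ^+ 2 = 1)%g.
  apply/permP=> -[y|]; rewrite expgS expg1 permM perm1 ?s1 // !s2 !mul1r.
  by rewrite -addrA (addrr_pchar2F cardF) addr0.
exists s => //; split=> //.
  apply: nt_prime_order => //; apply/eqP=> s11; move: (s2 0%R) t0.
  by rewrite s11 perm1 mul1r add0r => -[<-]; rewrite eqxx.
apply: (@traceless_invol _ a (a * t + b)%R e).
  have -> : (a * a - (a * t + b) * e = a * d - b * e - a * (t * e - (a - d)))%R.
    by ring.
  by rewrite /t divfK // (subr_pchar2F cardF a d) subrr mulr0 subr0.
have sE : s =1 moebius 1%R t 0%R 1%R.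
  case=> [y|]; rewrite /= ?s1 ?s2 ?eqxx //.
  by rewrite mul0r add0r oner_eq0 divr1.
move=> y; rewrite permM sE E moebius_comp //; last first.
  by rewrite mulr1 mulr0 subr0 oner_eq0.
congr moebius; rewrite ?mulr0 ?mulr1 ?addr0 //.
by rewrite /t mulrC divfK // -addrA (addrr_pchar2F cardF) addr0.
Qed.

End Stabilisers.

(** The translations preserving A, as a subgroup of the additive group. *)
Definition translators (F : finFieldType) (A : {set F}) : {set F} :=
  [set b | [forall t in A, (t + b)%R \in A]].

(** For the orders 2 and 3 this is the set W of the introduction. *)
Definition fixed_by (F : finFieldType) (ords : pred nat) (B : {set option F}) :=
  [set x in B | [exists h in stab B, (h x == x) && ords #[h]%g]].

Section FixedBy.
Variables (n : nat) (F : finFieldType).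
Hypothesis cardF : #|F| = (2 ^ n)%N.
Local Notation G := (PSL2 F).
Local Notation X := (option F).
Implicit Types (c g h s : {perm X}) (B : {set X}) (A : {set F}).
Local Open Scope nat_scope.

Lemma translatorsP A (b : F) :
  reflect (forall t, t \in A -> (t + b)%R \in A) (b \in translators A).
Proof. by rewrite inE; apply: forall_inP. Qed.

Lemma translators0 A : 0%R \in translators A.
Proof. by apply/translatorsP=> t tA; rewrite addr0. Qed.

Lemma translatorsD A (b b' : F) : b \in translators A -> b' \in translators A ->
  (b + b')%R \in translators A.
Proof.
move=> /translatorsP bA /translatorsP b'A; apply/translatorsP=> t tA.
by rewrite addrA b'A ?bA.
Qed.

(** The translations preserving A act freely both on the field and on A, so
    their number divides 2^n and 12. *)
Lemma card_translators A : #|A| = 12 -> #|translators A| \in [:: 1; 2; 4].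
Proof.
move=> A12; pose cl (x : F) := [set (x + b)%R | b in translators A].
have dvd (S : {set F}) : (forall x, x \in S -> cl x \subset S) ->
    #|translators A| %| #|S|.
  move=> clS; have k0 : 0 < #|translators A|.
    by apply/card_gt0P; exists 0%R; apply: translators0.
  rewrite (@card_classes _ S cl #|translators A|) ?dvdn_mull //.
  - by move=> x xS; apply/imsetP; exists 0%R; rewrite ?translators0 // addr0.
  - move=> x y xS /imsetP[b bA ->]; apply/setP=> z; apply/imsetP/imsetP.
      by case=> b' b'A ->; exists (b + b')%R; rewrite ?addrA // translatorsD.
    case=> b' b'A ->; exists (b + b')%R; first by rewrite translatorsD.
    by rewrite addrA -(addrA x) (addrr_pchar2F cardF) addr0.
  - by move=> x xS; rewrite card_imset //; apply: addrI.
have := dvd A; rewrite A12 => dvd12.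
have := dvd [set: F]; rewrite cardsT cardF => dvdq.
have {dvdq}/dvdn_pfactor[//|i _ ei] : #|translators A| %| 2 ^ n.
  by apply: dvdq => x _; apply: subsetT.
have : 2 ^ i %| 12.
  rewrite -ei; apply: dvd12 => x xA; apply/subsetP=> _ /imsetP[b /translatorsP bA ->].
  exact: bA.
rewrite ei; case: i {ei} => [|[|[|i]]] // /(dvdn_trans _) H.
by have /H : 8 %| 2 ^ i.+3 by rewrite !expnS !mulnA dvdn_mulr.
Qed.

Lemma fixed_byP (ords : pred nat) B (x : X) :
  reflect (x \in B /\ exists h, [/\ h \in stab B, h x = x & ords #[h]%g])
          (x \in fixed_by ords B).
Proof.
rewrite inE; apply: (iffP andP) => -[xB].
  by case/exists_inP=> h hB /andP[/eqP hx o]; split=> //; exists h.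
by case=> h [hB hx o]; split=> //; apply/exists_inP; exists h; rewrite // hx eqxx.
Qed.

Lemma imset_permM B g h : [set h y | y in [set g x | x in B]] =
  [set (g * h)%g x | x in B].
Proof. by rewrite -imset_comp; apply: eq_imset => x; rewrite /= permM. Qed.

Lemma stabJ B g c : g \in G ->
  ((c ^ g)%g \in stab [set g x | x in B]) = (c \in stab B).
Proof.
move=> gG; apply/stabP/stabP=> -[cG cB]; split.
- by rewrite groupJr in cG.
- move=> x; have := cB (g x); rewrite !permM permK.
  by rewrite !(mem_imset _ _ perm_inj).
- by rewrite groupJ.
- move=> x; rewrite -{2}(permKV g x) !permM mem_imset; last exact: perm_inj.
  by rewrite cB -(mem_imset _ _ (@perm_inj _ g)) permKV.
Qed.

Lemma fixed_byJ (ords : pred nat) B g (x : X) : g \in G ->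
  (g x \in fixed_by ords [set g y | y in B]) = (x \in fixed_by ords B).
Proof.
suff imp C h y : h \in G -> y \in fixed_by ords C ->
    h y \in fixed_by ords [set h z | z in C].
  move=> gG; apply/idP/idP; last exact: imp.
  move/(imp _ g^-1%g); rewrite groupV permK imset_permM mulgV => /(_ gG).
  by rewrite (eq_imset _ (@perm1 _)) imset_id.
move=> hG /fixed_byP[yC [c [cC cy oc]]]; apply/fixed_byP; split.
  exact: imset_f.
exists (c ^ h)%g; rewrite stabJ // orderJ; split=> //.
by rewrite !permM permK cy.
Qed.

Lemma stab_mem B c (x : X) : c \in stab B -> (c x \in B) = (x \in B).
Proof. by case/stabP. Qed.

Lemma stab_mem_cycle B c (x y : X) : c \in stab B -> x \in B ->
  y \in orbit ('P)%act <[c]>%g x -> y \in B.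
Proof.
move=> cB xB /orbitP[d dc <-]; rewrite /= apermE stab_mem //.
by move: dc; apply: subsetP; rewrite cycle_subG.
Qed.

Lemma affine_expg g (a b x : F) k : (forall y, g (Some y) = Some (a * y + b)%R) ->
  (g ^+ k)%g (Some x) = Some (a ^+ k * x + (\sum_(i < k) a ^+ i) * b)%R.
Proof.
move=> gE; elim: k => [|k IH].
  by rewrite expg0 perm1 big_ord0 expr0 mul1r mul0r addr0.
rewrite expgSr permM IH gE big_ord_recl exprS; congr Some.
rewrite [in RHS](eq_bigr (fun i : 'I_k => a * a ^+ i))%R => [|j _]; last by rewrite exprS.
by rewrite -mulr_sumr; ring.
Qed.

(** The fixed-point equation is solvable when a <> 1, so the order of x -> a x
    + b is that of a. *)
Lemma affine_expg1 g (a b : F) k : g None = None ->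
    (forall y, g (Some y) = Some (a * y + b)%R) -> (a != 1)%R ->
  (g ^+ k == 1)%g = (a ^+ k == 1)%R.
Proof.
move=> g1 gE a1; apply/eqP/eqP=> [gk|ak].
  have := affine_expg 1%R k gE; have := affine_expg 0%R k gE.
  by rewrite gk !perm1 mulr0 add0r mulr1 => -[<-] []; rewrite addr0.
have s0 : (\sum_(i < k) a ^+ i = 0)%R.
  apply: (mulfI (x := (a - 1)%R)); first by rewrite subr_eq0.
  by rewrite -subrX1 ak subrr mulr0.
apply/permP=> -[x|]; rewrite perm1 ?(affine_expg _ _ gE) ?ak ?s0.
  by rewrite mul1r mul0r addr0.
by elim: k {ak s0} => [|k IH]; rewrite ?perm1 // expgSr permM IH.
Qed.

Lemma translation_sq1 g (b : F) : g None = None ->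
  (forall y, g (Some y) = Some (1 * y + b)%R) -> (g ^+ 2 = 1)%g.
Proof.
move=> g1 gE; apply/permP=> -[y|]; rewrite expgS expg1 permM perm1 ?g1 //.
by rewrite !gE !mul1r -addrA (addrr_pchar2F cardF) addr0.
Qed.

(** Take x to be infinity. If c and h commute, then h permutes the two fixed
    points of c in B and fixes one of them. Otherwise their commutator is a
    nontrivial translation preserving the 12 finite points of B, and so are
    its 11 conjugates under the powers of c, contradicting the bound of 4 on
    the number of such translations. *)
Lemma order11_stab_point B c h (x y : X) : #|B| = 13 ->
    c \in stab B -> h \in stab B -> x \in B -> c x = x -> h x = x ->
    #[c]%g = 11 -> y \in B -> c y = y -> h y = y.
Proof.
wlog -> : B c h x y / x = None.
  move=> W B13 cB hB xB cx hx c11 yB cy.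
  have [g gG gx] := to_infty x; apply: (@perm_inj _ g).
  have := W [set g x | x in B] (c ^ g)%g (h ^ g)%g (g x) (g y) gx.
  rewrite card_imset; last exact: perm_inj.
  rewrite !stabJ // !mem_imset; try exact: perm_inj.
  rewrite !permM !permK orderJ cx hx cy => W'.
  exact: W'.
move=> B13 cB hB xB cx hx c11 yB cy.
have [->//|yx] := eqVneq y None.
have cG := subsetP (stab_sub B) _ cB; have hG := subsetP (stab_sub B) _ hB.
have [a a0 [b cE]] := affineP cG cx; have [a' a'0 [b' hE]] := affineP hG hx.
pose A : {set F} := [set t | Some t \in B].
have A12 : #|A| = 12.
  have : #|B| = 1 + #|Some @: A|.
    rewrite (cardsD1 (None : X) B) xB; congr (_ + _); apply: eq_card => -[t|].
      by rewrite !inE /= mem_imset ?inE // => ? ? [].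
    by rewrite !inE /=; apply/esym/negP=> /imsetP[].
  by rewrite B13 card_imset => [[]|? ? []].
pose t := (a' * b + b' - (a * b' + b))%R.
have com z : (h (c (Some z)) = Some ((a * (a' * z + b') + b) + t)%R).
  by rewrite cE hE; congr Some; rewrite /t; ring.
have [t0|t0] := eqVneq t 0%R.
  have {}com z : h (c z) = c (h z).
    by case: z => [z|]; rewrite ?cx ?hx // com t0 addr0 hE cE.
  apply/eqP/negPn/negP => hy.
  have : #|[set None; y; h y]| <= #|'Fix_(B | 'P)[c]%g|.
    apply: subset_leq_card; apply/subsetP=> z.
    rewrite mem_fixP !inE => /orP[/orP[]|] /eqP->; rewrite ?xB ?yB ?cx ?cy ?eqxx //.
    by rewrite stab_mem // yB -com cy eqxx.
  have hyN : h y != None by rewrite -hx (inj_eq perm_inj).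
  rewrite setUC cardsU1 cards2 !inE (negPf hy) (negPf hyN) eq_sym yx.
  by have := prime_order_fix B13 cB; rewrite c11 /= => /(_ isT); rewrite orbF => /eqP ->.
have AE z : (Some z \in B) = (z \in A) by rewrite inE.
have tA : t \in translators A.
  apply/translatorsP=> z; rewrite -!AE => zB.
  (* The preimage of z under the map x -> c (h x). *)
  pose w := (a'^-1 * (a^-1 * (z - b) - b'))%R.
  have wE : (a * (a' * w + b') + b = z)%R by rewrite /w; field; rewrite a0.
  rewrite -{1}wE -com !stab_mem //.
  by rewrite -(stab_mem _ hB) -(stab_mem _ cB) hE cE wE.
have aA z : z \in translators A -> (a * z)%R \in translators A.
  move=> /translatorsP zA; apply/translatorsP=> u; rewrite -!AE => uB.
  have : ((u - b) / a)%R \in A.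
    by rewrite -AE -(stab_mem _ cB) cE mulrC divfK // subrK.
  move=> /zA; rewrite -AE -(stab_mem _ cB) cE mulrDr (mulrC a) divfK //.
  by rewrite addrAC subrK.
have a1 : (a != 1)%R.
  apply/eqP=> a1; rewrite a1 in cE.
  have := translation_sq1 cx cE => /eqP; rewrite -order_dvdn c11 //.
(* The 11 translations conjugate to x -> x + t under the powers of c. *)
pose f (i : 'I_11) := (a ^+ i * t)%R.
have finj : injective f.
  suff H (i j : 'I_11) : i <= j -> f i = f j -> i = j.
    by move=> i j ij; case: (leqP i j) => [|/ltnW] /H; [apply | move/(_ (esym ij))].
  move=> lij /(mulIf t0) e; apply/eqP; rewrite -val_eqE /= eqn_leq lij /=.
  rewrite leqNgt; apply/negP=> ltij; have : (a ^+ (j - i)%N = 1)%R.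
    by apply: (mulfI (expf_neq0 i a0)); rewrite -exprD subnKC // mulr1 -e.
  move/eqP; rewrite -(affine_expg1 _ cx cE a1) -order_dvdn c11.
  move/dvdn_leq; rewrite subn_gt0 => /(_ ltij).
  by rewrite leqNgt (leq_ltn_trans (leq_subr _ _) (ltn_ord j)).
have : #|f @: [set: 'I_11]| <= #|translators A|.
  apply: subset_leq_card; apply/subsetP=> _ /imsetP[[i ltI] _ ->]; rewrite /f /= {ltI}.
  elim: i => [|i IH]; first by rewrite expr0 mul1r.
  by rewrite exprS -mulrA aA.
rewrite card_imset // cardsT card_ord; have := card_translators A12.
by rewrite !inE => /or3P[] /eqP ->.
Qed.

End FixedBy.

(** * The stabiliser of a block *)

Notation centres23 := (fixed_by (pred2 2%N 3%N)).
Notation centres11 := (fixed_by (pred1 11%N)).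

Definition has_order (F : finFieldType) p (B : {set option F}) :=
  [exists h in stab B, #[h]%g == p].

Section Classification.
Variables (n : nat) (F : finFieldType).
Hypothesis cardF : #|F| = (2 ^ n)%N.
Local Notation G := (PSL2 F).
Local Notation X := (option F).
Implicit Types (c g h s : {perm X}) (B : {set X}) (A : {set F}).
Local Open Scope nat_scope.

Lemma card_cycle_orbit c (x : X) : prime #[c]%g -> c x != x ->
  #|orbit ('P)%act <[c]>%g x| = #[c]%g.
Proof.
move=> pc cx; have := dvdn_orbit 'P%act <[c]>%G x; rewrite -orderE.
case/primeP: pc => _ /[apply] /orP[/cards1P[y oy]|/eqP //].
have ho (d : {perm X}) : d \in <[c]>%g -> d x = y.
  by move=> dc; apply/set1P; rewrite -oy; apply: (mem_orbit 'P%act x dc).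
by move: cx; rewrite (ho c) ?cycle_id // -{1}(ho 1%g) ?group1 // perm1 eqxx.
Qed.

Section Block.
Variable B : {set X}.
Hypothesis B13 : #|B| = 13.

Lemma card_fix_order11 c : c \in stab B -> #[c]%g = 11 ->
  #|'Fix_(B | 'P)[c]%g| = 2.
Proof.
move=> cB c11; have := prime_order_fix B13 cB; rewrite c11 /=.
by move/(_ isT); rewrite orbF => /eqP.
Qed.

Lemma card_fix_order13 c : c \in stab B -> #[c]%g = 13 ->
  #|'Fix_(B | 'P)[c]%g| = 0.
Proof.
by move=> cB c13; have := prime_order_fix B13 cB; rewrite c13 => /(_ isT)/eqP.
Qed.

Lemma card_fix_order23 c : c \in stab B -> #[c]%g \in [:: 2; 3] ->
  #|'Fix_(B | 'P)[c]%g| = 1.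
Proof.
move=> cB; rewrite !inE => /orP[] /eqP c2; have := prime_order_fix B13 cB;
by rewrite c2 /= orbF => /(_ isT)/eqP.
Qed.

(** An involution s of G fixes x and inverts c; it preserves B because B is
    the union of the c-orbit of x, which s reverses, and of all fixed points
    of c that lie in B, which for order 11 are all fixed points of c on the
    line. *)
Lemma moved_points_are_centres c (x : X) : c \in stab B ->
  #[c]%g \in [:: 11; 13] -> x \in B -> c x != x -> x \in centres23 B.
Proof.
move=> cB oc xB cx; have cG := subsetP (stab_sub B) _ cB.
have pc : prime #[c]%g by move: oc; rewrite !inE => /orP[] /eqP ->.
have c2 : (c * c != 1)%g.
  rewrite -expg2 -order_dvdn.
  by move: oc; rewrite !inE => /orP[] /eqP ->.
have [s sG [s2 sx sc]] := inverting_involution cardF cG c2 cx.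
have ss : (s * s = 1)%g by apply/eqP; rewrite -expg2 -order_dvdn s2.
have sV : (s^-1 = s)%g by apply/eqP; rewrite eq_invg_mul ss.
have cs : (c ^ s = c^-1)%g.
  apply/eqP; rewrite eq_sym eq_invg_mul conjgE sV.
  have -> : (c * (s * (c * s)) = s^-1 * (s * c * (s * c)) * s)%g.
    by rewrite !mulgA mulVg mul1g.
  by rewrite sc mulg1 mulVg.
apply/fixed_byP; split=> //; exists s; split=> //; last by rewrite /= s2.
apply/stabP; split=> //.
suff sB y : y \in B -> s y \in B.
  move=> y; apply/idP/idP; last exact: sB.
  by move/sB; rewrite -permM ss perm1.
(* Two orbits of length 11 or 13 do not fit into B. *)
move=> yB; have [yo|yo] := boolP (y \in orbit 'P%act <[c]>%g x).
  case/orbitP: yo => d /cycleP[i ->] <-; rewrite /= apermE -permM conjgC permM sx.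
  by rewrite conjXg cs stab_mem // groupX ?groupV.
have [cy|cy] := eqVneq (c y) y; last first.
  have yoS : [disjoint orbit 'P%act <[c]>%g x & orbit 'P%act <[c]>%g y].
    apply/pred0P=> z /=; apply: contraNF yo => /andP[zx zy].
    by rewrite -(orbit_eqP zx) (orbit_eqP zy) orbit_refl.
  have : #|orbit 'P%act <[c]>%g x :|: orbit 'P%act <[c]>%g y| <= #|B|.
    apply: subset_leq_card; rewrite subUset; apply/andP.
    by split; apply/subsetP=> z; apply: stab_mem_cycle.
  rewrite cardsU (disjoint_setI0 yoS) cards0 subn0 !card_cycle_orbit // B13.
  by move: oc; rewrite !inE => /orP[] /eqP ->.
move: oc; rewrite !inE => /orP[] /eqP oc; last first.
  have /eqP := card_fix_order13 cB oc; rewrite cards_eq0 => /eqP/setP/(_ y).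
  by rewrite mem_fixP yB cy eqxx inE.
have /eqP fixE : 'Fix_(B | 'P)[c]%g == 'Fix_([set: X] | 'P)[c]%g.
  rewrite eqEcard setSI ?subsetT // (card_fix_order11 cB oc) card_fix_le2 //.
  by rewrite -order_eq1 oc.
have : s y \in 'Fix_([set: X] | 'P)[c]%g.
  rewrite mem_fixP inE -permM.
  have -> : (s * c = c^-1 * s)%g by rewrite [RHS]conjgC conjVg cs invgK.
  have cVy : (c^-1)%g y = y by rewrite -[y in LHS]cy permK.
  by rewrite permM cVy eqxx.
by rewrite -fixE mem_fixP => /andP[].
Qed.
(** An element of order 2 or 3 has one fixed point in B, but at x it would
    have to fix both fixed points of c. *)
Lemma centres_disjoint (x : X) : x \in centres23 B -> x \notin centres11 B.
Proof.
move=> /fixed_byP[xB [h [hB hx oh]]]; apply/negP=> /fixed_byP[_ [c [cB cx /eqP oc]]].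
have : #|'Fix_(B | 'P)[c]%g| <= #|'Fix_(B | 'P)[h]%g|.
  apply: subset_leq_card; apply/subsetP=> y; rewrite !mem_fixP => /andP[yB /eqP cy].
  by rewrite yB (order11_stab_point cardF B13 cB hB xB cx hx oc yB cy) eqxx.
rewrite card_fix_order11 // card_fix_order23 //.
by move: oh => /= ; rewrite !inE.
Qed.

(** The points moved by c are centres of order 2 or 3, its fixed points are
    centres of order 11, and the two kinds exclude each other. *)
Lemma centres_order11 c : c \in stab B -> #[c]%g = 11 ->
  centres23 B = B :\: 'Fix_(B | 'P)[c]%g /\ centres11 B = 'Fix_(B | 'P)[c]%g.
Proof.
move=> cB oc.
have subZ (x : X) : x \in 'Fix_(B | 'P)[c]%g -> x \in centres11 B.
  rewrite mem_fixP => /andP[xB /eqP cx]; apply/fixed_byP; split=> //.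
  by exists c; split=> //=; rewrite oc.
have subW (x : X) : x \in B :\: 'Fix_(B | 'P)[c]%g -> x \in centres23 B.
  case/setDP=> xB; rewrite mem_fixP xB /= => cx.
  by apply: (moved_points_are_centres cB) => //; rewrite oc.
have subB (x : X) ords : x \in fixed_by ords B -> x \in B by case/fixed_byP.
split; apply/setP=> x; apply/idP/idP; auto.
- move=> xW; rewrite inE (subB _ _ xW) andbT.
  by apply/negP=> /subZ; apply/negP; apply: centres_disjoint.
- move=> xZ; apply/negPn/negP=> nx; have : x \in centres23 B.
    by apply: subW; rewrite inE nx (subB _ _ xZ).
  by move/centres_disjoint; rewrite xZ.
Qed.

Lemma centres_order13 c : c \in stab B -> #[c]%g = 13 ->
  centres23 B = B /\ centres11 B = set0.
Proof.
move=> cB oc; have subW : centres23 B = B.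
  apply/setP=> x; apply/idP/idP; first by case/fixed_byP.
  move=> xB; apply: (moved_points_are_centres cB) => //; first by rewrite oc.
  have /eqP := card_fix_order13 cB oc; rewrite cards_eq0 => /eqP/setP/(_ x).
  by rewrite mem_fixP xB inE /= => ->.
split=> //; apply/setP=> x; rewrite in_set0; apply/negP => xZ.
have : x \in centres23 B by rewrite subW; case/fixed_byP: xZ.
by move/centres_disjoint; rewrite xZ.
Qed.

Lemma prime_power_in_stab h : h \in stab B -> h != 1%g ->
  exists k, [/\ (h ^+ k)%g \in stab B & prime #[h ^+ k]%g].
Proof.
move=> hB h1; have o1 : 1 < #[h]%g by rewrite order_gt1.
have pp := pdiv_prime o1; exists (#[h]%g %/ pdiv #[h]%g).
split; first by rewrite groupX.
by rewrite orderXdiv ?dvdn_div ?pdiv_dvd // divnA ?pdiv_dvd // mulKn ?order_gt0.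
Qed.

Lemma fix_expg h k (x : X) : h x = x -> (h ^+ k)%g x = x.
Proof. by move=> hx; elim: k => [|k IH]; rewrite ?perm1 // expgSr permM IH. Qed.

Lemma sub_fix_expg h k : 'Fix_(B | 'P)[h]%g \subset 'Fix_(B | 'P)[h ^+ k]%g.
Proof.
apply/subsetP=> x; rewrite !mem_fixP => /andP[-> /eqP hx].
by rewrite fix_expg ?eqxx.
Qed.

Lemma has_orderP p :
  reflect (exists2 h, h \in stab B & #[h]%g = p) (has_order p B).
Proof. exact: exists_eq_inP. Qed.

Lemma order23_or h : h \in stab B -> prime #[h]%g ->
  ~~ has_order 11 B -> ~~ has_order 13 B -> #[h]%g \in [:: 2; 3].
Proof.
move=> hB ph n11 n13; have := prime_order_fix B13 hB ph; rewrite !inE.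
case/or3P=> /andP[] // /eqP oh _.
  by case/has_orderP: n11; exists h.
by case/has_orderP: n13; exists h.
Qed.

(** Every nonidentity element has a power of order 2 or 3; it commutes with
    that power, so it fixes its unique fixed point in B and no other point of
    B. Therefore the stabiliser has a common fixed point, the only centre. *)
Lemma centres_generic : stab B != [set 1%g] ->
  ~~ has_order 11 B -> ~~ has_order 13 B -> #|centres23 B| = 1.
Proof.
move=> s1 n11 n13; have fix1 h : h \in (stab B)^#%g -> #|'Fix_(B | 'P)[h]%g| = 1.
  case/setD1P=> h1 hB; have [k [kB pk]] := prime_power_in_stab hB h1.
  have k1 := card_fix_order23 kB (order23_or kB pk n11 n13).
  rewrite -k1; apply/eqP; rewrite eqn_leq subset_leq_card ?sub_fix_expg //=.
  apply: subset_leq_card; apply/subsetP=> x xk.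
  have /eqP/cards1P[y ey] := k1; move: (xk); rewrite {1}ey inE => /eqP xy.
  move: (xk); rewrite !mem_fixP => /andP[xB /eqP kx]; rewrite xB /=.
  have : h x \in 'Fix_(B | 'P)[h ^+ k]%g.
    by rewrite mem_fixP stab_mem // xB -permM -expgS expgSr permM kx eqxx.
  by rewrite ey inE xy.
have [x xB xfix] := common_fixed_point (stab_acts B) s1 fix1.
apply/eqP/cards1P; exists x; apply/setP=> y; rewrite inE.
apply/fixed_byP/eqP=> [[yB [h [hB hy oh]]]|->].
  have : h \in (stab B)^#%g.
    by apply/setD1P; split=> //; rewrite -order_eq1; case/orP: oh => /eqP ->.
  move/fix1/eqP/cards1P=> [z ez].
  have : y \in 'Fix_(B | 'P)[h]%g by rewrite mem_fixP yB hy eqxx.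
  have : x \in 'Fix_(B | 'P)[h]%g by rewrite mem_fixP xB; apply/eqP/xfix.
  by rewrite ez !inE => /eqP -> /eqP ->.
split=> //; have /trivgPn[h hB h1] := s1.
have [k [kB pk]] := prime_power_in_stab hB h1.
by exists (h ^+ k)%g; split; [| apply: xfix | have := order23_or kB pk n11 n13; rewrite !inE].
Qed.

Lemma card_centres11 : #|centres11 B| = 2 * has_order 11 B.
Proof.
have [/has_orderP[c cB oc]|n11] := boolP (has_order 11 B).
  by rewrite (centres_order11 cB oc).2 card_fix_order11.
rewrite (_ : centres11 B = set0) ?cards0 //; apply/setP=> x; rewrite [RHS]inE.
apply/negP=> /fixed_byP[_ [h [hB _ /eqP oh]]].
by case/has_orderP: n11; exists h.
Qed.

Lemma order11_not13 : has_order 11 B -> ~~ has_order 13 B.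
Proof.
move=> h11; apply/has_orderP=> -[c cB oc]; have := card_centres11.
by rewrite h11 (centres_order13 cB oc).2 cards0.
Qed.

(** The number of centres is 0 for a rigid block, 1 in the generic case, 11 =
    1 + 10 with elements of order 11 and 13 = 1 + 12 with elements of order
    13. *)
Lemma card_centres23 : #|centres23 B| + (stab B == [set 1%g]) =
  1 + 10 * has_order 11 B + 12 * has_order 13 B.
Proof.
have nt p : 1 < p -> has_order p B -> stab B != [set 1%g].
  move=> p1 /has_orderP[h hB oh]; apply/trivgPn; exists h => //.
  by rewrite -order_gt1 oh.
have [h11|n11] := boolP (has_order 11 B).
  rewrite (negPf (nt _ _ h11)) // (negPf (order11_not13 h11)).
  have /has_orderP[c cB oc] := h11; rewrite (centres_order11 cB oc).1.
  by rewrite cardsD (setIidPr (subsetIl _ _)) card_fix_order11 // B13.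
have [h13|n13] := boolP (has_order 13 B).
  have /has_orderP[c cB oc] := h13.
  by rewrite (negPf (nt _ _ h13)) // (centres_order13 cB oc).1 B13.
have [s1|s1] := eqVneq (stab B) [set 1%g]; last by rewrite centres_generic.
rewrite (_ : centres23 B = set0) ?cards0 //; apply/setP=> x; rewrite [RHS]inE.
apply/negP=> /fixed_byP[_ [h []]]; rewrite s1 => /set1P ->.
by rewrite order1.
Qed.

(** The stabiliser is transitive on B, so by the Cauchy-Frobenius formula its
    elements have one fixed point in B on average. The identity has 13 and the
    others at most one, elements of order 11 being excluded, so exactly 12
    elements have none. The powers of c account for all of them. *)
Lemma card_order13 : has_order 13 B ->
  #|[set h in stab B | #[h]%g == 13]| = 12.
Proof.
move=> h13; have /has_orderP[c cB oc] := h13.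
have n11 : ~~ has_order 11 B by apply: contraL h13; apply: order11_not13.
pose free := [set h in stab B | #|'Fix_(B | 'P)[h]%g| == 0].
have sub13 : [set h in stab B | #[h]%g == 13] \subset free.
  apply/subsetP=> h; rewrite inE => /andP[hB /eqP oh].
  by rewrite inE hB card_fix_order13.
have ge12 : 12 <= #|[set h in stab B | #[h]%g == 13]|.
  have c12 : #|(<[c]>^#)%g| = 12.
    by have := cardsD1 1%g <[c]>%g; rewrite group1 -orderE oc => -[].
  rewrite -[X in X <= _]c12 subset_leq_card //.
  apply/subsetP=> h /setD1P[h1 hc]; rewrite inE.
  have hB : h \in stab B by move: hc; apply: subsetP; rewrite cycle_subG.
  rewrite hB; have : #[h]%g %| 13 by rewrite -oc; apply: order_dvdG.
  have o1 : #[h]%g != 1 by rewrite order_eq1.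
  by move/(prime_nt_dvdP (isT : prime 13) o1) => ->.
have le12 : #|free| <= 12.
  have orb1 : [set orbit ('P)%act (stab B) x | x in B] = [set B].
    have oB x : x \in B -> orbit ('P)%act (stab B) x = B.
      move=> xB; apply/eqP; rewrite eqEcard B13 acts_sub_orbit ?stab_acts // xB /=.
      rewrite -oc -(@card_cycle_orbit c x) ?oc //.
        by apply: subset_leq_card; apply: imsetS; rewrite cycle_subG.
      have /eqP := card_fix_order13 cB oc; rewrite cards_eq0 => /eqP/setP/(_ x).
      by rewrite mem_fixP xB inE /= => ->.
    apply/setP=> O; rewrite inE; apply/imsetP/eqP=> [[x xB ->]|->]; first exact: oB.
    have /card_gt0P[x xB] : 0 < #|B| by rewrite B13.
    by exists x; rewrite ?oB.
  have := Frobenius_Cauchy (stab_acts B); rewrite orb1 cards1 mul1n.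
  rewrite (bigD1 1%g) ?group1 //= => sumE.
  have f1 : #|'Fix_(B | 'P)[1]%g| = 13.
    by rewrite -B13; apply: eq_card => x; rewrite mem_fixP perm1 eqxx andbT.
  have fle h : h \in stab B -> h != 1%g -> #|'Fix_(B | 'P)[h]%g| = (h \notin free).
    move=> hB h1; rewrite inE hB /=; suff : #|'Fix_(B | 'P)[h]%g| <= 1.
      by case: #|_| => [|[|]].
    have [k [kB pk]] := prime_power_in_stab hB h1.
    apply: leq_trans (subset_leq_card (sub_fix_expg h k)) _.
    have := prime_order_fix B13 kB pk; case/or3P=> /andP[o /eqP -> //].
    by case/has_orderP: n11; exists (h ^+ k)%g => //; apply/eqP.
  have cS : #|stab B| = #|free| + #|stab B :\: free|.
    rewrite -(cardsID free (stab B)); congr (_ + _).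
    by apply: eq_card => h; rewrite in_setI [h \in free]inE andbA andbb.
  have cS' : 1 + \sum_(h in stab B | h != 1%g) (h \notin free) = #|stab B :\: free|.
    have -> : 1 = (1%g \notin free) by rewrite inE f1 group1.
    rewrite -(bigD1 1%g) ?group1 //= -sum1_card big_mkcond [RHS]big_mkcond /=.
    by apply: eq_bigr => h _; rewrite in_setD; case: (h \in stab B); case: (h \in free).
  move: sumE; rewrite f1 (eq_bigr (fun h => (h \notin free) : nat)); last first.
    by move=> h /andP[]; apply: fle.
  rewrite cS -cS'; move: (\sum_(h in _ | _) _) => u.
  by move: (#|free|) => v; lia.
by apply/eqP; rewrite eqn_leq ge12 (leq_trans (subset_leq_card sub13)).
Qed.
End Block.
End Classification.

(** * Summation over all blocks *)

Definition blocks13 (F : finFieldType) : {set {set option F}} :=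
  [set B : {set option F} | #|B| == 13].

Definition blocks_with_order (F : finFieldType) p : {set {set option F}} :=
  [set B in blocks13 F | has_order p B].

(** By transitivity of the group it suffices to look at one point. *)
Definition blocks_at_infty (F : finFieldType) (ords : pred nat) :
  {set {set option F}} := [set B in blocks13 F | None \in fixed_by ords B].

Section Census.
Variables (n : nat) (F : finFieldType).
Hypothesis cardF : #|F| = (2 ^ n)%N.
Local Notation G := (PSL2 F).
Local Notation X := (option F).
Implicit Types (c g h s : {perm X}) (B : {set X}) (A : {set F}).
Local Open Scope nat_scope.

Lemma sum_bool (T : finType) (A : {set T}) (P : pred T) :
  \sum_(x in A) (P x : nat) = #|[set x in A | P x]|.
Proof.
rewrite -sum1_card big_mkcond [RHS]big_mkcond /=; apply: eq_bigr => x _.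
by rewrite inE; case: (x \in A) => //; case: (P x).
Qed.

Lemma sum_fixed_by ords :
  \sum_(B in blocks13 F) #|fixed_by ords B| =
  (2 ^ n).+1 * #|blocks_at_infty F ords|.
Proof.
transitivity (\sum_(B in blocks13 F) \sum_(x in [set: X]) (x \in fixed_by ords B)).
  apply: eq_bigr => B _; rewrite sum_bool; apply: eq_card => x.
  by rewrite [RHS]inE in_setT.
rewrite exchange_big /= -(card_line cardF) -cardsT -sum_nat_const.
apply: eq_bigr => x _; rewrite sum_bool; have [g gG gx] := to_infty x.
have ginj : injective (fun B => [set g y | y in B]) by apply/imset_inj/perm_inj.
rewrite -(card_imset _ ginj); apply: eq_card => B; rewrite [RHS]inE.
apply/imsetP/andP => [[C + ->]|[]].
  rewrite inE [C \in _]inE => /andP[C13 xC].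
  split; last by rewrite -gx fixed_byJ.
  by rewrite inE card_imset ?C13 //; apply: perm_inj.
have BE : B = [set g y | y in [set (g^-1)%g y | y in B]].
  rewrite imset_permM mulVg -[LHS]imset_id.
  by apply: eq_imset => y; rewrite perm1.
rewrite inE => B13 BN; exists [set (g^-1)%g y | y in B] => //.
rewrite inE [X in X && _]inE card_imset ?B13; last exact: perm_inj.
by rewrite -(fixed_byJ _ _ _ gG) -BE gx.
Qed.

Lemma census23 : (2 ^ n).+1 * #|blocks_at_infty F (pred2 2 3)| + #|rigid13 F| =
  'C((2 ^ n).+1, 13) + 10 * #|blocks_with_order F 11|
                     + 12 * #|blocks_with_order F 13|.
Proof.
have c13 : #|blocks13 F| = 'C((2 ^ n).+1, 13).
  by rewrite card_draws (card_line cardF).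
have rE : rigid13 F = [set B in blocks13 F | stab B == [set 1%g]].
  by apply/setP=> B; rewrite !in_set.
rewrite -sum_fixed_by rE -sum_bool -big_split /= -c13 -sum1_card.
rewrite -!sum_bool !big_distrr -!big_split /=; apply: eq_bigr => B.
by rewrite inE => /eqP B13; exact: (card_centres23 cardF B13).
Qed.

Lemma census11 :
  (2 ^ n).+1 * #|blocks_at_infty F (pred1 11)| = 2 * #|blocks_with_order F 11|.
Proof.
rewrite -sum_fixed_by -sum_bool big_distrr; apply: eq_bigr => B.
by rewrite inE => /eqP B13; exact: (card_centres11 cardF B13).
Qed.

Definition order13_moving_infty : {set {perm X}} :=
  [set c in G | (#[c]%g == 13) && (c None != None)].

Lemma card_moving13 (x : X) :
  #|[set c in G | (#[c]%g == 13) && (c x != x)]| = #|order13_moving_infty|.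
Proof.
have [g gG gx] := to_infty x; rewrite -(card_imset _ (@conjg_inj _ g)).
apply: eq_card => c; rewrite [RHS]inE -gx; apply/imsetP/and3P=> [[d + ->]|[cG oc cx]].
  rewrite inE => /and3P[dG od dx]; rewrite groupJ // orderJ od.
  by rewrite !permM permK (inj_eq perm_inj).
exists (c ^ g^-1)%g; last by rewrite conjgKV.
rewrite inE groupJ ?groupV // orderJ oc /= conjgE invgK !permM.
by rewrite -(inj_eq (@perm_inj _ g)) permKV.
Qed.

(** If c moves x, the only block through x preserved by c is the orbit of x;
    an element of order 13 that fixes a point of a block does not preserve the
    block. *)
Lemma card_blocks_of_order13 c (x : X) : c \in G -> #[c]%g = 13 ->
  #|[set B in blocks13 F | (c \in stab B) && (x \in B)]| = (c x != x).
Proof.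
move=> cG oc; have [cx|cx] := eqVneq (c x) x; rewrite /=.
  apply/eqP; rewrite cards_eq0; apply/eqP/setP=> B; rewrite [LHS]inE [RHS]inE.
  rewrite inE; apply/negP=> /and3P[/eqP B13 cB xB].
  have /eqP := card_fix_order13 B13 cB oc; rewrite cards_eq0 => /eqP/setP/(_ x).
  by rewrite mem_fixP xB cx eqxx inE.
have co : #|orbit ('P)%act <[c]>%g x| = 13.
  by rewrite -oc; apply: card_cycle_orbit; rewrite ?oc.
apply/eqP/cards1P; exists (orbit ('P)%act <[c]>%g x); apply/setP=> B.
rewrite in_set1 inE [B \in _]inE; apply/and3P/eqP=> [[/eqP B13 cB xB]|->].
  apply/esym/eqP; rewrite eqEcard co B13 leqnn andbT; apply/subsetP=> y.
  exact: stab_mem_cycle.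
split; rewrite ?orbit_refl ?co //; apply/stabP; split=> // y.
have yy : c y \in orbit 'P%act <[c]>%g y by apply: (mem_orbit 'P%act y (cycle_id c)).
by rewrite !(orbit_sym _ _ _ x) -!orbit_eq_mem (orbit_eqP yy).
Qed.

(** Double count of the triples (B, c, x) with c of order 13 preserving B and
    x in B; a block with elements of order 13 contributes 12 * 13 = 156. *)
Lemma census13 : 156 * #|blocks_with_order F 13| = (2 ^ n).+1 * #|order13_moving_infty|.
Proof.
have -> : (2 ^ n).+1 * #|order13_moving_infty| = \sum_(x : X) \sum_(c in G | #[c]%g == 13) (c x != x).
  rewrite -(card_line cardF) -sum_nat_const; apply: eq_bigr => x _.
  rewrite -(card_moving13 x) -sum_bool big_mkcondr; apply: eq_bigr => c _.
  by case: eqP.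
transitivity (\sum_(B in blocks13 F) \sum_(c in G | #[c]%g == 13)
    \sum_(x : X) ((c \in stab B) && (x \in B))); last first.
  rewrite exchange_big /= [RHS]exchange_big /=.
  apply: eq_bigr => c /andP[cG /eqP oc]; rewrite exchange_big /=.
  by apply: eq_bigr => x _; rewrite -(card_blocks_of_order13 x cG oc) sum_bool.
rewrite -sum_bool big_distrr; apply: eq_bigr => B; rewrite inE => /eqP B13 /=.
transitivity (\sum_(c in G | #[c]%g == 13) (c \in stab B) * 13).
  rewrite -big_distrl /= big_mkcondr /=.
  have -> : 156 * has_order 13 B = #|[set h in stab B | #[h]%g == 13]| * 13.
    have [h13|n13] := boolP (has_order 13 B); first by rewrite (card_order13 cardF).
    rewrite (_ : [set h in _ | _] = set0) ?cards0 //; apply/setP=> h.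
    rewrite inE in_set0; apply/negP=> /andP[hB /eqP oh].
    by case/has_orderP: n13; exists h.
  congr (_ * 13); rewrite -sum_bool big_mkcond [RHS]big_mkcond.
  apply: eq_bigr => h _; case: (boolP (h \in stab B)) => [hB|_]; last first.
    by case: ifP => // _; case: ifP.
  by rewrite (subsetP (stab_sub B)) //; case: eqP.
apply: eq_bigr => c _; case: (c \in stab B) => /=; last by rewrite big1.
rewrite mul1n -B13 -sum1_card [LHS]big_mkcond; apply: eq_bigr => x _.
by case: (x \in B).
Qed.
End Census.

Local Open Scope ring_scope.

(** * Elements of order 13 *)

(** X^q - X is the product of the X - x over all x in the field. *)
Lemma card_roots_dvd (F : finFieldType) (p : {poly F}) :
  p %| 'X^#|F| - 'X -> #|[set x | root p x]| = (size p).-1.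
Proof.
rewrite finField_genPoly -big_enum => /dvdp_prod_XsubC[m pm].
rewrite (eqp_size pm) size_prod_XsubC /= -(card_uniqP _); last first.
  by rewrite mask_uniq ?enum_uniq.
apply: eq_card => x; rewrite inE (eqp_root pm).
by rewrite -[X in \prod_(i <- X) _]map_id big_map root_prod_XsubC.
Qed.

Section Rotations.
Variables (n : nat) (F : finFieldType).
Hypothesis cardF : #|F| = (2 ^ n)%N.
Local Notation G := (PSL2 F).
Local Notation X := (option F).

(** The minimal polynomial over GF(2) of z + 1/z, for z a primitive 13th root
    of unity. *)
Definition psi13 (R : nzRingType) (y : R) : R := y ^+ 6 + y ^+ 5 + y ^+ 4 + y + 1.

Let two0 : 2 = 0 :> F.
Proof. by rewrite -[2]/(1 + 1) (addrr_pchar2F cardF). Qed.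

Let ptwo0 : 2 = 0 :> {poly F}.
Proof. by rewrite -polyC_natr two0 polyC0. Qed.

(** Squaring three times from X^8 = X^5 + X^3 + X; every step holds up to a
    multiple of 2. *)
Lemma psi13_X64 : psi13 ('X : {poly F}) %| 'X^64 - 'X.
Proof.
set x : {poly F} := 'X; set psi := psi13 x.
have mod2 (a b e q : {poly F}) : a + 2 * e = psi * q + b -> psi %| a - b.
  by rewrite ptwo0 mul0r addr0 => ->; rewrite addrK dvdp_mulr.
have sq (a b c : {poly F}) : psi %| a - b -> psi %| b ^+ 2 - c -> psi %| a ^+ 2 - c.
  move=> ab bc; rewrite -(subrK (b ^+ 2) (a ^+ 2)) -addrA dvdp_add //.
  by rewrite subr_sqr dvdp_mulr.
have h8 : psi %| x ^+ 8 - (x ^+ 5 + x ^+ 3 + x).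
  (* The last argument is the quotient by psi over GF(2); the other one is
     half the discrepancy over the integers. *)
  apply: (@mod2 _ _ (x ^+ 7 + x ^+ 6 + x ^+ 5 + x ^+ 3 + x ^+ 2 + x) (x ^+ 2 + x)).
  by rewrite /psi /psi13; ring.
have h16 : psi %| (x ^+ 8) ^+ 2 - (x ^+ 3 + x).
  apply: (sq _ _ _ h8).
  apply: (@mod2 _ _ (x ^+ 9 + x ^+ 7 - x ^+ 6 + x ^+ 5 + x ^+ 3 + x) (x ^+ 4 + x ^+ 3 + x)).
  by rewrite /psi /psi13; ring.
have h32 : psi %| ((x ^+ 8) ^+ 2) ^+ 2 - (x ^+ 5 + x ^+ 4 + x ^+ 2 + x + 1).
  apply: (sq _ _ _ h16).
  apply: (@mod2 _ _ (x ^+ 5 + x + 1) 1).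
  by rewrite /psi /psi13; ring.
have -> : x ^+ 64 = (((x ^+ 8) ^+ 2) ^+ 2) ^+ 2 by rewrite -!exprM.
apply: (sq _ _ _ h32).
apply: (@mod2 _ _ (x ^+ 8 - x ^+ 6 - x ^+ 5 - x ^+ 2) (x ^+ 4 + x ^+ 3 + x ^+ 2 + 1)).
by rewrite /psi /psi13; ring.
Qed.

Lemma dvdp_iter_sub (p : {poly F}) (k m : nat) : p %| 'X^m - 'X -> p %| 'X^(m ^ k) - 'X.
Proof.
move=> pm; elim: k => [|k IH]; first by rewrite expn0 expr1 subrr dvdp0.
rewrite -(subrK 'X^m 'X^(m ^ k.+1)) -addrA dvdp_add // expnSr exprM.
by rewrite subrXX dvdp_mulr.
Qed.

Lemma horner_psi13 (y : F) : (psi13 ('X : {poly F})).[y] = psi13 y.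
Proof. by rewrite /psi13 !hornerE. Qed.

Lemma psi13_root64 (y : F) : psi13 y = 0 -> y ^+ 64 = y.
Proof.
move=> y0; apply/eqP; rewrite -subr_eq0; have /dvdpP[k /(congr1 (fun p => p.[y]))] := psi13_X64.
by rewrite hornerM horner_psi13 y0 mulr0 !hornerE => ->.
Qed.

Lemma psi13_no_root4 (y : F) : psi13 y = 0 -> y ^+ 4 = y -> False.
Proof.
move=> y0 y4.
have : 1 = 0 :> F; last by move/eqP; rewrite oner_eq0.
(* Reduce the exponents 6, 5 and 4 by y^4 = y. *)
have cub : y ^+ 3 + y ^+ 2 + 1 = 0.
  rewrite -{}y0 /psi13 -[X in _ = X](_ : y ^+ 4 * y ^+ 2 + y ^+ 4 * y + y ^+ 4 + y + 1 = _); last by ring.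
  rewrite y4 -[RHS](subrK (y * 2)) two0 mulr0 addr0 subr0.
  have -> : y * y ^+ 2 + y * y + y + y + 1 = y ^+ 3 + y ^+ 2 + 1 + y * 2 by ring.
  by rewrite two0 mulr0 addr0.
have y3 : y ^+ 3 = 0.
  transitivity (y ^+ 4 + y ^+ 3 + y); last by rewrite -(mulr0 y) -cub; ring.
  by rewrite y4 addrAC (addrr_pchar2F cardF) add0r.
have : y = 0 by apply/eqP; move/eqP: y3; rewrite expf_eq0.
by move: cub => /[swap] ->; rewrite !expr0n /= !add0r.
Qed.

Lemma psi13_no_root8 (y : F) : psi13 y = 0 -> y ^+ 8 = y -> False.
Proof.
move=> y0 y8; have e : y ^+ 3 * (y + 1) ^+ 2 = 0.
  have : y ^+ 8 + 2 * (y ^+ 7 + y ^+ 6 + y ^+ 5 + y ^+ 3 + y ^+ 2 + y) =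
    psi13 y * (y ^+ 2 + y) + (y ^+ 5 + y ^+ 3 + y) by rewrite /psi13; ring.
  rewrite y8 y0 two0 !mul0r addr0 add0r => /eqP; rewrite -subr_eq0 => /eqP e.
  rewrite -[RHS]oppr0 -{}e.
  have -> : - (y - (y ^+ 5 + y ^+ 3 + y)) = y ^+ 3 * (y + 1) ^+ 2 - 2 * y ^+ 4 by ring.
  by rewrite two0 mul0r subr0.
(* So y is 0 or 1, and in both cases y^4 = y. *)
apply: (psi13_no_root4 y0); move/eqP: e; rewrite mulf_eq0 !expf_eq0 /=.
rewrite addr_eq0 (oppr_pchar2F cardF) => /orP[] /eqP ->; last by rewrite expr1n.
by rewrite expr0n.
Qed.

Lemma size_psi13 : size (psi13 ('X : {poly F})) = 7%N.
Proof.
rewrite /psi13 -!addrA size_polyDl size_polyXn //.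
do 2! (apply: (leq_ltn_trans (size_polyD _ _)); rewrite gtn_max size_polyXn /=).
by rewrite size_XaddC.
Qed.

(** A root y satisfies y^64 = y and y^(2^n) = y, hence y^4 = y or y^8 = y if 6
    does not divide n, and neither is compatible with the equation. If 6
    divides n the polynomial divides X^q - X. *)
Lemma card_psi13_roots : #|[set y : F | psi13 y == 0]| = (if 6 %| n then 6 else 0)%N.
Proof.
have -> : [set y : F | psi13 y == 0] = [set y | root (psi13 ('X : {poly F})) y].
  by apply/setP=> y; rewrite !inE rootE horner_psi13.
case: ifP => [/dvdnP[k nk]|n6].
  rewrite card_roots_dvd ?size_psi13 //.
  rewrite cardF nk mulnC expnM (_ : (2 ^ 6 = 64)%N) //.
  exact: dvdp_iter_sub psi13_X64.
apply/eqP; rewrite cards_eq0; apply/eqP/setP=> y; rewrite !inE rootE horner_psi13.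
apply/negP=> /eqP y0; have y64 := psi13_root64 y0.
have y6k k : y ^+ (64 ^ k) = y.
  by elim: k => [|k IH]; rewrite ?expr1 // expnS exprM y64.
have yr : y ^+ (2 ^ (n %% 6)) = y.
  rewrite -[RHS](expf_card y) cardF {2}(divn_eq n 6) mulnC expnD expnM exprM.
  by rewrite (_ : (2 ^ 6 = 64)%N) // y6k.
have := ltn_pmod n (isT : 0 < 6)%N; move: yr n6; rewrite /dvdn.
case: (n %% 6)%N => [|[|[|[|[|[|//]]]]]] // yr _ _.
- by apply: (psi13_no_root4 y0); rewrite (exprM _ 2 2) !yr.
- exact: (psi13_no_root4 y0).
- exact: (psi13_no_root8 y0).
- by apply: (psi13_no_root4 y0); rewrite -[RHS]y64 (exprM _ 16 4) yr.
- have y2 : y ^+ 2 = y by rewrite -[RHS]y64 (exprM _ 32 2) yr.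
  by apply: (psi13_no_root4 y0); rewrite (exprM _ 2 2) !y2.
Qed.
End Rotations.

(** Consecutive terms of the Lucas sequence with parameters t and e: a 2 by 2
    matrix M with trace t and determinant e satisfies M^(k+1) = u_(k+1) M - e
    u_k. *)
Fixpoint lucas (R : pzRingType) (t e : R) (k : nat) : R * R :=
  if k is k'.+1 then let: (u, v) := lucas t e k' in (v, t * v - e * u)
  else (0, 1).

Lemma lucasS (R : pzRingType) (t e : R) k : lucas t e k.+1 =
  let: (u, v) := lucas t e k in (v, t * v - e * u).
Proof. by []. Qed.

Lemma lucas_snd (R : pzRingType) (t e : R) k : (lucas t e k).2 = (lucas t e k.+1).1.
Proof. by rewrite lucasS; case: (lucas t e k). Qed.

Section Rotations.
Variables (n : nat) (F : finFieldType).
Hypothesis cardF : #|F| = (2 ^ n)%N.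
Local Notation G := (PSL2 F).
Local Notation X := (option F).

Lemma moebius_power (a b d : F) (g : {perm X}) k :
    a * d - b != 0 -> g =1 moebius a b 1 d ->
    let uv := lucas (a + d) (a * d - b) k in
    (uv.2 * a - (a * d - b) * uv.1) * (uv.2 * d - (a * d - b) * uv.1) -
      (uv.2 * b) * uv.2 != 0 /\
    (g ^+ k.+1)%g =1 moebius (uv.2 * a - (a * d - b) * uv.1) (uv.2 * b)
                           uv.2 (uv.2 * d - (a * d - b) * uv.1).
Proof.
move=> D gE; elim: k => [|k] /=.
  by rewrite !mulr0 !subr0 !mul1r mulr1.
case: (lucas _ _ k) => u v /= [IH1 IH2]; split.
  have -> : ((a + d) * v - (a * d - b) * u) * a - (a * d - b) * v =
     a * (v * a - (a * d - b) * u) + b * v by ring.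
  have -> : ((a + d) * v - (a * d - b) * u) * d - (a * d - b) * v =
     b * v + d * (v * d - (a * d - b) * u) by ring.
  rewrite [X in X != 0](_ : _ = (a * d - b) *
    ((v * a - (a * d - b) * u) * (v * d - (a * d - b) * u) - (v * b) * v)); last by ring.
  by rewrite mulf_neq0.
move=> x; rewrite expgSr permM IH2 gE moebius_comp ?mulr1 //.
by congr moebius; ring.
Qed.

(** In characteristic 2, with y = t^2 / e, this is e^6 (y^6 + y^5 + y^4 + y +
    1). *)
Lemma psi13_lucas (t e : F) :
  (lucas t e 13).1 = t ^+ 12 + e * t ^+ 10 + e ^+ 2 * t ^+ 8 + e ^+ 5 * t ^+ 2 + e ^+ 6.
Proof.
rewrite /=.
transitivity (t ^+ 12 + e * t ^+ 10 + e ^+ 2 * t ^+ 8 + e ^+ 5 * t ^+ 2 + e ^+ 6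
  + 2 * (- 6 * e * t ^+ 10 + 22 * e ^+ 2 * t ^+ 8 - 42 * e ^+ 3 * t ^+ 6
         + 35 * e ^+ 4 * t ^+ 4 - 11 * e ^+ 5 * t ^+ 2)); first by ring.
by rewrite (_ : 2 = 0) ?mul0r ?addr0 // -[2]/(1 + 1) (addrr_pchar2F cardF).
Qed.

(** The power g^13 is the identity if and only if it fixes infinity, if and
    only if the Lucas number u_13 vanishes. *)
Lemma order13_trace (a b d : F) (g : {perm X}) :
    a * d - b != 0 -> g =1 moebius a b 1 d ->
  (#[g]%g == 13%N) = (a + d != 0) && (psi13 ((a + d) ^+ 2 / (a * d - b)) == 0).
Proof.
move=> D gE.
have g1 : g != 1%g.
  apply/eqP => g1; have := gE None.
  by rewrite g1 perm1 /= oner_eq0.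
have -> : (#[g]%g == 13%N) = (g ^+ 13 == 1)%g.
  rewrite -order_dvdn; apply/eqP/idP => [-> //|].
  by move/(prime_nt_dvdP (isT : prime 13)); apply; rewrite order_eq1.
have vE := psi13_lucas (a + d) (a * d - b).
have {}vE := etrans (lucas_snd (a + d) (a * d - b) 12) vE.
have [] := moebius_power 12 D gE.
move: vE; move: (lucas (a + d) (a * d - b) 12).1 (lucas (a + d) (a * d - b) 12).2.
move=> u v vE D13 g13.
have -> : (g ^+ 13 == 1)%g = (v == 0).
  apply/eqP/eqP=> [g130|v0].
    by have := g13 None; rewrite g130 perm1 /=; case: eqP.
  apply/permP=> x; rewrite perm1 g13; move: D13; rewrite v0 !mul0r !sub0r subr0.
  rewrite mulf_eq0 orbb => s0; case: x => [x|] /=; last by rewrite eqxx.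
  by rewrite mul0r add0r (negPf s0) addr0 mulrAC divff // mul1r.
rewrite vE; have [->|t0] := eqVneq (a + d) 0.
  by rewrite !expr0n /= !mulr0 !add0r expf_eq0 (negPf D).
rewrite /=.
have -> : psi13 ((a + d) ^+ 2 / (a * d - b)) = ((a + d) ^+ 12 + (a * d - b) * (a + d) ^+ 10 +
   (a * d - b) ^+ 2 * (a + d) ^+ 8 + (a * d - b) ^+ 5 * (a + d) ^+ 2 + (a * d - b) ^+ 6) /
   (a * d - b) ^+ 6 by rewrite /psi13; field.
by rewrite mulf_eq0 invr_eq0 (expf_eq0 _ 6) (negPf D) orbF.
Qed.

(** A matrix with lower left entry 1 is given by its upper left entry a, its
    trace t and its invariant y = t^2 / det; the conditions are t <> 0 and
    psi13 y = 0, and a is arbitrary. *)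
Lemma card_order13_moving_infty :
  #|order13_moving_infty F| = (2 ^ n * (2 ^ n).-1 * (if 6 %| n then 6 else 0))%N.
Proof.
pose det (u : F * F * F) := u.1.2 ^+ 2 / u.2.
pose S : {set F * F * F} := [set u | (u.1.2 != 0) && (psi13 u.2 == 0)].
have psi0 (y : F) : psi13 y == 0 -> y != 0.
  by apply: contraTneq => ->; rewrite /psi13 !expr0n /= !add0r oner_eq0.
have ex (u : F * F * F) : exists g : {perm X}, u \in S -> g \in G /\
    g =1 moebius u.1.1 (u.1.1 * (u.1.1 + u.1.2) - det u) 1 (u.1.1 + u.1.2).
  have [uS|] := boolP (u \in S); last by exists 1%g.
  have [|g gG gE] := @moebius_perm _ u.1.1 (u.1.1 * (u.1.1 + u.1.2) - det u) 1 (u.1.1 + u.1.2).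
    move: uS; rewrite inE => /andP[t0 /psi0 y0].
    by rewrite mulr1 opprB addrCA subrr addr0 mulf_neq0 ?invr_eq0 ?expf_neq0.
  by exists g.
have {ex}/fin_all_exists[f fP] := ex.
have detE (a t : F) y : a * (a + t) - (a * (a + t) - det (a, t, y)) = t ^+ 2 / y.
  by rewrite /det /=; ring.
have tr (a t : F) : a + (a + t) = t by rewrite addrA (addrr_pchar2F cardF) add0r.
have finj : {in S &, injective f}.
  move=> [[a t] y] [[a' t'] y'] uS u'S e.
  have [_ /= fE] := fP _ uS; have [_ /= f'E] := fP _ u'S; rewrite e in fE.
  have := fE None; rewrite f'E /= oner_eq0 !divr1 => -[ea]; subst a'.
  have et : t' = t.
    (* The pole of the map is a + t, so the map determines t. *)
    have := fE (Some (a + t)); rewrite f'E /= !mul1r (addrr_pchar2F cardF) eqxx.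
    case: eqP => // + _; rewrite addrACA (addrr_pchar2F cardF) add0r.
    by move/eqP; rewrite addr_eq0 (oppr_pchar2F cardF) => /eqP.
  subst t'.
  have := fE (Some (a + t + 1)); rewrite f'E /= !mul1r [a + t + 1 + _]addrAC (addrr_pchar2F cardF) add0r.
  rewrite oner_eq0 !divr1 => -[/addrI/addrI/oppr_inj]; rewrite /det /=.
  move: uS; rewrite inE /= => /andP[t0 _] /mulfI.
  by rewrite expf_eq0 t0 => /(_ isT)/invr_inj ->.
transitivity #|f @: S|.
  apply: eq_card => c; rewrite inE; apply/and3P/imsetP=> [[cG oc cN]|[[[a t] y] uS ->]].
    have /PSL2P[a [b [e [d [D E]]]]] := cG.
    have e0 : e != 0 by move: cN; rewrite E /=; case: ifP.
    have scale x : moebius a b e d x = moebius (a / e) (b / e) 1 (d / e) x.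
      case: x => [x|] /=; last by rewrite (negPf e0) oner_eq0 divr1.
      have -> : 1 * x + d / e = (e * x + d) / e by field.
      rewrite mulf_eq0 invr_eq0 (negPf e0) orbF; case: eqP => // /eqP n0.
      by congr Some; field; rewrite n0 e0.
    have {}E x : c x = moebius (a / e) (b / e) 1 (d / e) x by rewrite E scale.
    have {}D : (a / e) * (d / e) - b / e != 0.
      have -> : (a / e) * (d / e) - b / e = (a * d - b * e) / e ^+ 2 by field.
      by rewrite mulf_neq0 ?invr_eq0 ?expf_neq0.
    move: oc; rewrite (order13_trace D E); move: D E.
    move: (a / e) (b / e) (d / e) => {scale e e0}a {}b {}d D E /andP[t0 y0].
    have uS : (a, a + d, (a + d) ^+ 2 / (a * d - b)) \in S by rewrite inE /= t0.
    exists (a, a + d, (a + d) ^+ 2 / (a * d - b)) => //.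
    have [_ /= fE] := fP _ uS; apply/permP=> x; rewrite E fE /det /= tr.
    congr moebius; rewrite invf_div mulrCA divff ?mulr1 ?expf_neq0 //.
    by rewrite opprB addrCA subrr addr0.
  have [fG fE] := fP _ uS; rewrite fG fE /= oner_eq0.
  move: (uS); rewrite inE /= => /andP[t0 y0].
  have D : a * (a + t) - (a * (a + t) - det (a, t, y)) != 0.
    by rewrite detE mulf_neq0 ?expf_neq0 // invr_eq0 psi0.
  rewrite (order13_trace D fE) tr t0 detE; split=> //.
  by rewrite invf_div mulrCA divff ?mulr1 ?expf_neq0.
rewrite (card_in_imset finj).
have -> : S = setX (setX [set: F] [set~ 0]) [set y : F | psi13 y == 0].
  by apply/setP=> -[[a t] y]; rewrite !inE.
by rewrite !cardsX cardsT cardsC1 cardF (card_psi13_roots cardF).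
Qed.
End Rotations.

(** * Blocks with a special point at infinity *)

Definition mu (F : finFieldType) (p : nat) : {set F} := [set a : F | a ^+ p == 1].

(** The centres z such that all rotations x -> a (x - z) + z with a^p = 1
    preserve A. *)
Definition rotcentres (F : finFieldType) (p : nat) (A : {set F}) : {set F} :=
  [set z | [forall a in mu F p, forall x in A, a * (x - z) + z \in A]].

Definition sets12 (F : finFieldType) : {set {set F}} := [set A : {set F} | #|A| == 12%N].

Definition translated12 (F : finFieldType) : {set {set F}} :=
  [set A in sets12 F | translators A != [set 0]].

Definition rotated12 (F : finFieldType) (p : nat) : {set {set F}} :=
  [set A in sets12 F | rotcentres p A != set0].

Section AtInfinity.
Variables (n : nat) (F : finFieldType).
Hypothesis cardF : #|F| = (2 ^ n)%N.
Local Notation G := (PSL2 F).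
Local Notation X := (option F).
Implicit Types (A : {set F}).

Lemma muP p (a : F) : reflect (a ^+ p = 1) (a \in mu F p).
Proof. by rewrite inE; apply: eqP. Qed.

Lemma rotcentresP p A (z : F) :
  reflect (forall a x, a \in mu F p -> x \in A -> a * (x - z) + z \in A)
          (z \in rotcentres p A).
Proof.
rewrite inE; apply: (iffP forall_inP) => [H a x /H/forall_inP|H a ap]; first exact.
by apply/forall_inP=> x; apply: H.
Qed.

(** It is used to pass from one rotation of prime order to all rotations with
    the same centre. *)
Lemma prime_mu_generated p (a a' : F) : prime p -> a != 1 -> a \in mu F p ->
  a' \in mu F p -> exists i, a' = a ^+ i.
Proof.
move=> pp a1 /muP ap /muP a'p.
have [m pm mp] := prim_order_exists (prime_gt0 pp) ap.
have m1 : m != 1%N.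
  by apply: contraNneq a1 => m1; move: pm; rewrite m1 => /prim_expr_order; rewrite expr1 => ->.
have pp' : p.-primitive_root a by rewrite -(prime_nt_dvdP pp m1 mp).
by have [i ->] := prim_rootP pp' a'p; exists i.
Qed.

Lemma rotcentre_of_rotation p A (a z : F) : prime p -> a != 1 -> a \in mu F p ->
  (forall x, x \in A -> a * (x - z) + z \in A) -> z \in rotcentres p A.
Proof.
move=> pp a1 ap aA; apply/rotcentresP=> a' x a'p xA.
have [i ->] := prime_mu_generated pp a1 ap a'p.
elim: i => [|i IH]; first by rewrite expr0 mul1r subrK.
have := aA _ IH; rewrite addrK exprS mulrA; exact.
Qed.

Definition extend A : {set X} := None |: Some @: A.

Lemma mem_extend A (x : F) : (Some x \in extend A) = (x \in A).
Proof. by rewrite in_setU1 /= mem_imset // => ? ? []. Qed.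

Lemma infty_extend A : None \in extend A.
Proof. exact: setU11. Qed.

Lemma card_extend A : #|extend A| = #|A|.+1.
Proof.
rewrite cardsU1 card_imset => [|? ? [] //].
by rewrite (_ : None \notin _) //; apply/imsetP => -[].
Qed.

Lemma extend_inj : injective extend.
Proof. by move=> A A' e; apply/setP=> x; rewrite -!mem_extend e. Qed.

Lemma stab_closed (B : {set X}) h : h \in G -> (forall x, x \in B -> h x \in B) ->
  h \in stab B.
Proof.
move=> hG hB; have e : [set h x | x in B] = B.
  apply/eqP; rewrite eqEcard card_imset ?leqnn ?andbT; last exact: perm_inj.
  by apply/subsetP=> _ /imsetP[x xB ->]; apply: hB.
by apply/stabP; split=> // x; rewrite -{1}e mem_imset //; apply: perm_inj.
Qed.

Lemma order_affine (h : {perm X}) (a b : F) p : prime p -> h None = None ->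
    (forall x, h (Some x) = Some (a * x + b)) ->
  #[h]%g = p <-> (a = 1 /\ b != 0 /\ p = 2%N) \/ (a != 1 /\ a ^+ p = 1).
Proof.
move=> pp h1 hE; have [a1|a1] := eqVneq a 1.
  rewrite a1 in hE *; have h2 := translation_sq1 cardF h1 hE.
  have hb : (h != 1%g) = (b != 0).
    congr negb; apply/eqP/eqP=> [h11|b0].
      by move: (hE 0); rewrite h11 perm1 mulr0 add0r => -[].
    by apply/permP=> -[x|]; rewrite perm1 ?h1 // hE b0 mul1r addr0.
  split=> [oh|[[_ [b0 ->]]|[]//]]; last by apply: nt_prime_order; rewrite ?hb.
  left; rewrite -hb -order_gt1 oh prime_gt1 //; split=> //; split=> //.
  have : (#[h]%g %| 2)%N by rewrite order_dvdn h2.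
  by rewrite oh dvdn_prime2 // => /eqP.
have hp := affine_expg1 p h1 hE a1; split=> [oh|[[/eqP]|[_ ap]]].
- by right; split=> //; apply/eqP; rewrite -hp -oh expg_order.
- by rewrite (negPf a1).
- apply: nt_prime_order => //; first by apply/eqP; rewrite hp ap.
  apply/eqP=> h11; have := affine_expg1 1 h1 hE a1.
  by rewrite h11 expg1n eqxx expr1 (negPf a1).
Qed.

Lemma infty_fixed_byP (ords : pred nat) A : #|A| = 12%N ->
    (forall p, ords p -> prime p) ->
  reflect (exists a b, [/\ a != 0, forall x, x \in A -> a * x + b \in A &
    exists2 p, ords p & (a = 1 /\ b != 0 /\ p = 2%N) \/ (a != 1 /\ a ^+ p = 1)])
   (None \in fixed_by ords (extend A)).
Proof.
move=> A12 ordsP; apply: (iffP (fixed_byP _ _ _)) => [[_ [h [hB h1 oh]]]|].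
  have [a a0 [b hE]] := affineP (subsetP (stab_sub _) _ hB) h1.
  exists a, b; split=> // [x xA|]; first by rewrite -mem_extend -hE stab_mem ?mem_extend.
  by exists #[h]%g => //; apply/(order_affine (ordsP _ oh) h1 hE).
case=> a [b [a0 aA [p op abp]]]; split; first exact: infty_extend.
have [h hG [h1 hE]] := affine_perm b a0.
exists h; split=> //.
  apply: stab_closed => // -[x|_]; last by rewrite h1 infty_extend.
  by rewrite hE !mem_extend; apply: aA.
by have/(order_affine (ordsP _ op) h1 hE) -> := abp.
Qed.

Lemma blocks_at_infty_extend ords :
  #|blocks_at_infty F ords| = #|[set A in sets12 F | None \in fixed_by ords (extend A)]|.
Proof.
rewrite -(card_imset _ extend_inj); apply: eq_card => B; rewrite inE.
apply/andP/imsetP=> [[B13 BN]|[A + ->]]; last first.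
  by rewrite !inE card_extend; case/andP=> /eqP -> ->.
have NB : None \in B by case/fixed_byP: BN.
have BE : B = extend [set x | Some x \in B].
  by apply/setP=> -[x|]; rewrite ?mem_extend ?inE.
exists [set x | Some x \in B] => //; rewrite inE -BE BN andbT.
by rewrite inE -eqSS -card_extend -BE; rewrite inE in B13.
Qed.

(** The centre of x -> a x + b is its fixed point b / (1 - a). *)
Lemma rotation_form (a b x : F) : a != 1 ->
  a * x + b = a * (x - b / (1 - a)) + b / (1 - a).
Proof. by move=> a1; field; rewrite subr_eq0 eq_sym. Qed.

Lemma not_sqrt1 (a : F) : a != 1 -> a ^+ 2 != 1.
Proof.
move=> a1; rewrite -subr_eq0.
have -> : a ^+ 2 - 1 = (a - 1) ^+ 2 + (a + a) - (1 + 1) by ring.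
by rewrite !(addrr_pchar2F cardF) addr0 subr0 expf_neq0 // subr_eq0.
Qed.

(** The condition on mu rules out that the only p-th root of unity is 1, when
    every point is vacuously a centre. *)
Lemma rotationsP p A : prime p ->
  (exists a b, [/\ a != 0, forall x, x \in A -> a * x + b \in A &
     a != 1 /\ a ^+ p = 1]) <->
  mu F p != [set 1] /\ rotcentres p A != set0.
Proof.
move=> pp; split=> [[a [b [a0 aA [a1 ap]]]]|[]].
  have am : a \in mu F p by apply/muP.
  split; first by apply: contraNneq a1 => m1; move: am; rewrite m1 inE.
  apply/set0Pn; exists (b / (1 - a)); apply: (rotcentre_of_rotation pp a1 am).
  by move=> x xA; rewrite -rotation_form // aA.
move=> m1 /set0Pn[z zA].
have [a am a1] : exists2 a, a \in mu F p & a != 1.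
  apply/exists_inP; apply: contraNT m1 => /exists_inPn H.
  rewrite eqEsubset; apply/andP; split; apply/subsetP=> a; rewrite in_set1.
    by move/H/negbNE.
  by move/eqP->; apply/muP; rewrite expr1n.
exists a, (z - a * z); split.
- apply: contraTneq am => ->; rewrite inE expr0n; case: p pp {zA m1} => //= p _.
  by rewrite eq_sym oner_eq0.
- move=> x xA; rewrite (_ : _ + _ = a * (x - z) + z); last by ring.
  by move/rotcentresP: zA; apply.
- by split=> //; apply/muP.
Qed.

Lemma translatedP A :
  (exists2 b, b != 0 & b \in translators A) <-> translators A != [set 0].
Proof.
split=> [[b b0 bA]|]; first by apply: contraNneq b0 => T0; move: bA; rewrite T0 inE.
move=> T0; apply/exists_inP; apply: contraNT T0 => /exists_inPn H.
rewrite eqEsubset; apply/andP; split; apply/subsetP=> b; rewrite in_set1.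
  by move=> bA; apply/negPn/negP=> b0; move: (H _ b0); rewrite bA.
by move/eqP->; apply: translators0.
Qed.

Lemma card_blocks_at_infty23 : #|blocks_at_infty F (pred2 2%N 3%N)| =
  #|translated12 F :|: (if mu F 3 == [set 1] then set0 else rotated12 F 3)|.
Proof.
rewrite blocks_at_infty_extend; apply: eq_card => A; rewrite inE [RHS]inE [in RHS]inE.
have -> : (A \in if mu F 3 == [set 1] then set0 else rotated12 F 3) =
   (A \in sets12 F) && (mu F 3 != [set 1]) && (rotcentres 3 A != set0).
  by case: eqP => /= _; rewrite inE ?andbT ?andbF.
rewrite -andbA -andb_orr; have [A12|//] := boolP (A \in sets12 F); rewrite /=.
rewrite inE in A12; move/eqP: A12 => A12.
have prp p : pred2 2%N 3%N p -> prime p by case/orP=> /eqP ->.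
apply/(infty_fixed_byP A12 prp)/orP=> [[a [b [a0 aA [p op]]]]|].
  case=> [[a1 [b0 _]]|[a1 ap]].
    left; apply/translatedP; exists b => //; apply/translatorsP=> x xA.
    by have := aA _ xA; rewrite a1 mul1r.
  have p3 : p = 3%N.
    by case/orP: op ap => /eqP -> // /eqP; rewrite (negPf (not_sqrt1 a1)).
  by right; apply/andP/(rotationsP _ (isT : prime 3)); exists a, b; rewrite -p3.
case=> [/translatedP[b b0 /translatorsP bA]|/andP/(rotationsP _ (isT : prime 3))].
  exists 1, b; split=> [|x xA|]; rewrite ?oner_neq0 ?mul1r ?bA //.
  by exists 2%N => //; left.
by case=> a [b [a0 aA a13]]; exists a, b; split=> //; exists 3%N => //; right.
Qed.

Lemma card_blocks_at_infty11 : #|blocks_at_infty F (pred1 11%N)| =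
  #|if mu F 11 == [set 1] then set0 else rotated12 F 11|.
Proof.
rewrite blocks_at_infty_extend; apply: eq_card => A.
rewrite inE.
have -> : (A \in if mu F 11 == [set 1] then set0 else rotated12 F 11) =
   (A \in sets12 F) && ((mu F 11 != [set 1]) && (rotcentres 11 A != set0)).
  by case: eqP => /= _; rewrite inE ?andbT ?andbF.
have [A12|//] := boolP (A \in sets12 F); rewrite /=.
rewrite inE in A12; move/eqP: A12 => A12.
have prp p : pred1 11%N p -> prime p by move/eqP=> ->.
apply/(infty_fixed_byP A12 prp)/andP=> [[a [b [a0 aA [p /eqP ->]]]]|].
  case=> [[_ [_ //]]|a11].
  by apply/(rotationsP _ (isT : prime 11)); exists a, b.
move/(rotationsP _ (isT : prime 11)).
by case=> a [b [a0 aA a11]]; exists a, b; split=> //; exists 11%N => //; right.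
Qed.
End AtInfinity.

(** * Sets of 12 points invariant under translations *)

(** By [card_translators] these are the sets whose group of translations is
    maximal, a Klein four-group. *)
Definition klein_translated12 (F : finFieldType) : {set {set F}} :=
  [set A in sets12 F | #|translators A| == 4%N].

Section Counts.
Variables (n : nat) (F : finFieldType).
Hypothesis cardF : #|F| = (2 ^ n)%N.
Implicit Types (A V : {set F}).

Lemma mu1 p : 1 \in mu F p.
Proof. by apply/muP; rewrite expr1n. Qed.

Lemma muM p (a a' : F) : a \in mu F p -> a' \in mu F p -> a * a' \in mu F p.
Proof. by move=> /muP ap /muP a'p; apply/muP; rewrite exprMn ap a'p mulr1. Qed.

Lemma muV p (a : F) : a \in mu F p -> a^-1 \in mu F p.
Proof. by move=> /muP ap; apply/muP; rewrite exprVn ap invr1. Qed.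

Lemma mu_neq0 p (a : F) : (0 < p)%N -> a \in mu F p -> a != 0.
Proof.
move=> p0 /muP ap; apply/eqP=> a0; move: ap; rewrite a0 expr0n -[p]prednK //=.
by move/eqP; rewrite eq_sym oner_eq0.
Qed.

Lemma card_mu p : (0 < p)%N -> (p %| (2 ^ n).-1)%N -> #|mu F p| = p.
Proof.
move=> p0 /dvdnP[k qk].
have sz : size ('X^p - 1 : {poly F}) = p.+1 by rewrite -polyC1 size_XnsubC.
have q0 : (0 < 2 ^ n)%N by rewrite expn_gt0.
transitivity #|[set x : F | root ('X^p - 1) x]|.
  by apply: eq_card => x; rewrite !inE rootE !hornerE subr_eq0.
rewrite card_roots_dvd ?sz // cardF.
have -> : 'X^(2 ^ n) - 'X = 'X * ('X^(p * k) - 1 ^+ k) :> {poly F}.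
  by rewrite expr1n mulrBr mulr1 -exprS mulnC -qk prednK.
by rewrite exprM dvdp_mull // subrXX dvdp_mulr.
Qed.

Lemma mu_trivial p : prime p -> ~~ (p %| (2 ^ n).-1)%N -> mu F p = [set 1].
Proof.
move=> pp npq; apply/setP=> a; rewrite in_set1; apply/idP/eqP=> [am|->]; last exact: mu1.
have a0 := mu_neq0 (prime_gt0 pp) am; move/muP: am => ap.
have [m pm mp] := prim_order_exists (prime_gt0 pp) ap.
have [m1|m1] := eqVneq m 1%N.
  by move: pm; rewrite m1 => /prim_expr_order; rewrite expr1.
case/negP: npq; rewrite -(prime_nt_dvdP pp m1 mp) (prim_order_dvd pm).
have q0 : (0 < 2 ^ n)%N by rewrite expn_gt0.
by apply/eqP/(mulfI a0); rewrite mulr1 -exprS prednK // -cardF expf_card.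
Qed.

(** The sets preserved by a group V of translations are the unions of cosets
    of V. *)
Lemma card_translated_by V j : 0 \in V ->
    (forall v w, v \in V -> w \in V -> v + w \in V) ->
  #|[set A : {set F} | (#|A| == #|V| * j)%N & V \subset translators A]| =
  'C(2 ^ n %/ #|V|, j).
Proof.
move=> V0 VD; pose cl (x : F) := [set x + v | v in V].
rewrite -cardF -cardsT -(@card_unions_of_classes _ [set: F] cl) //.
- apply: eq_card => A; rewrite !inE subsetT /=; congr (_ && _).
  apply/subsetP/forall_inP=> [VA x xA|clA v vV].
    by apply/subsetP=> _ /imsetP[v vV ->]; move/translatorsP: (VA v vV); apply.
  by apply/translatorsP=> x /clA/subsetP; apply; apply: imset_f.
- by move=> x _; apply/imsetP; exists 0; rewrite ?addr0.
- move=> x y _ /imsetP[v vV ->]; apply/setP=> z; apply/imsetP/imsetP=> -[w wV ->].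
    by exists (v + w); rewrite ?addrA // VD.
  by exists (v + w); rewrite ?VD // addrA -(addrA x) (addrr_pchar2F cardF) addr0.
- by move=> x _; rewrite card_imset //; apply: addrI.
- by apply/card_gt0P; exists 0.
Qed.

Lemma card_translated1 (b : F) : b != 0 ->
  #|[set A in sets12 F | b \in translators A]| = 'C(2 ^ n %/ 2, 6).
Proof.
move=> b0; have c2 : #|[set 0; b]| = 2%N by rewrite cards2 eq_sym b0.
rewrite -[X in (_ %/ X)%N]c2 -card_translated_by.
- apply: eq_card => A; rewrite [LHS]inE [RHS]inE [A \in _]inE c2; congr (_ && _).
  by rewrite subUset !sub1set translators0.
- by rewrite !inE eqxx.
- move=> v w; rewrite !inE => /orP[] /eqP-> /orP[] /eqP ->;
  by rewrite ?addr0 ?add0r ?(addrr_pchar2F cardF) eqxx ?orbT.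
Qed.

Lemma card_translated2 (b c : F) : b != 0 -> c != 0 -> c != b ->
  #|[set A in sets12 F | (b \in translators A) && (c \in translators A)]| =
  'C(2 ^ n %/ 4, 3).
Proof.
move=> b0 c0 cb; pose V := [set 0; b; c; b + c].
have c4 : #|V| = 4%N.
  rewrite /V setUC cardsU1 setUC cardsU1 cards2 !inE (eq_sym 0) b0 (negPf c0) (negPf cb) /=.
  by rewrite addr_eq0 (oppr_pchar2F cardF) (eq_sym b) (negPf cb) -subr_eq0 addrK
    (negPf b0) -subr_eq0 [b + c]addrC addrK (negPf c0).
rewrite -[X in (_ %/ X)%N]c4 -card_translated_by.
- apply: eq_card => A; rewrite [LHS]inE [RHS]inE [A \in _]inE c4; congr (_ && _).
  rewrite !subUset !sub1set translators0 /=; apply/andP/andP=> [[bA cA]|[/andP[-> ->] //]].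
  by rewrite bA cA translatorsD.
- by rewrite !inE eqxx.
- have bcb : b + c + b = c by rewrite addrAC (addrr_pchar2F cardF) add0r.
  have bcc : b + c + c = b by rewrite -addrA (addrr_pchar2F cardF) addr0.
  move=> v w; rewrite !inE => /orP[/orP[/orP[]|]|] /eqP-> /orP[/orP[/orP[]|]|] /eqP ->;
  by rewrite ?addr0 ?add0r ?(addrr_pchar2F cardF) ?bcb ?bcc ?(addrC c) ?(addrC b (b + c)) ?bcb ?bcc
       ?(addrC c (b + c)) ?bcc ?eqxx ?orbT.
Qed.

Lemma translatorsE A : A \in sets12 F ->
  (translators A != [set 0]) = (#|translators A| != 1%N) /\
  (#|translators A| != 1 -> #|translators A| != 4 -> #|translators A| = 2)%N.
Proof.
rewrite inE => /eqP A12; split.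
  congr negb; apply/eqP/eqP=> [->|]; first by rewrite cards1.
  move/eqP/cards1P=> [x ex]; rewrite ex; have := translators0 A.
  by rewrite ex inE => /eqP <-.
have := card_translators cardF A12.
by rewrite !inE => /or3P[] /eqP ->.
Qed.

(** Double count of the pairs (set, nonzero translation preserving it): a set
    has 0, 1 or 3 of these. *)
Lemma count_translators1 :
  (#|translated12 F| + 2 * #|klein_translated12 F| =
   (2 ^ n).-1 * 'C(2 ^ n %/ 2, 6))%N.
Proof.
transitivity (\sum_(b in [set~ (0%R : F)]) \sum_(A in sets12 F) (b \in translators A))%N.
  rewrite exchange_big /= /translated12 /klein_translated12 -!sum_bool big_distrr -big_split /=.
  apply: eq_bigr => A A12; have [-> T2] := translatorsE A12.
  rewrite sum_bool (_ : [set b in _ | _] = translators A :\ 0); last first.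
    by apply/setP=> b; rewrite !in_set.
  have := cardsD1 0 (translators A); rewrite translators0 add1n.
  have := T2; rewrite inE in A12; move/eqP: A12 => /(card_translators cardF).
  move: (#|translators A|) (#|translators A :\ 0%R|) => t s.
  by rewrite !inE => /or3P[] /eqP -> _ [<-].
rewrite (eq_bigr (fun=> 'C(2 ^ n %/ 2, 6))) => [|b]; last first.
  by rewrite !inE => b0; rewrite sum_bool card_translated1.
by rewrite sum_nat_const cardsC1 cardF.
Qed.

(** Double count over the ordered pairs of distinct nonzero translations; a
    Klein four-group has 6 such pairs. *)
Lemma count_translators2 :
  (6 * #|klein_translated12 F| = (2 ^ n).-1 * (2 ^ n - 2) * 'C(2 ^ n %/ 4, 3))%N.
Proof.
transitivity (\sum_(b in [set~ (0%R : F)]) \sum_(c in [set~ (0%R : F)] :\ b)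
   \sum_(A in sets12 F) ((b \in translators A) && (c \in translators A)))%N.
  under [RHS]eq_bigr => b _ do rewrite exchange_big.
  rewrite exchange_big /= /klein_translated12 -!sum_bool big_distrr /=.
  apply: eq_bigr => A A12.
  transitivity (\sum_(b in translators A :\ 0%R) #|translators A :\ 0%R :\ b|)%N.
    have := cardsD1 0 (translators A); rewrite translators0 add1n => cT.
    rewrite (eq_bigr (fun=> #|translators A|.-2)) => [|b bT]; last first.
      by have := cardsD1 b (translators A :\ 0); rewrite cT bT => ->.
    rewrite sum_nat_const; move: A12 cT; rewrite inE => /eqP/(card_translators cardF).
    move: (#|translators A|) (#|translators A :\ 0%R|) => t s.
    by rewrite !inE => /or3P[] /eqP -> [<-].
  rewrite [RHS](big_setID (translators A)) /= [X in (_ + X)%N]big1 ?addn0; last first.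
    by move=> b /setDP[_ /negPf bA]; rewrite big1 // => c _; rewrite bA.
  apply: eq_big => [b|b]; first by rewrite !in_set andbC.
  case/setD1P=> b0 bT; rewrite bT sum_bool; apply: eq_card => c.
  by rewrite !in_set andbA.
rewrite (eq_bigr (fun=> (2 ^ n - 2) * 'C(2 ^ n %/ 4, 3))%N) => [|b]; last first.
  rewrite in_setC1 => b0; rewrite (eq_bigr (fun=> 'C(2 ^ n %/ 4, 3))) => [|c].
    rewrite sum_nat_const; congr (_ * _)%N.
    have := cardsD1 b [set~ 0]; rewrite in_setC1 b0 cardsC1 cardF add1n.
    by move: (2 ^ n)%N (#|_ :\ b|) => u v; lia.
  by rewrite !inE => /andP[cb c0]; rewrite sum_bool card_translated2.
by rewrite sum_nat_const cardsC1 cardF mulnA.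
Qed.
End Counts.

(** * Sets of 12 points invariant under rotations *)

Section Rotated.
Variables (n : nat) (F : finFieldType).
Hypothesis cardF : #|F| = (2 ^ n)%N.
Implicit Types (A V : {set F}).

(** Composing a rotation about one centre with the inverse rotation about the
    other one gives a translation. *)
Lemma rotcentres_diff p A (a z z' : F) : (0 < p)%N -> a \in mu F p ->
  z \in rotcentres p A -> z' \in rotcentres p A ->
  (a - 1) * (z' - z) \in translators A.
Proof.
move=> p0 am /rotcentresP zA /rotcentresP z'A; have a0 := mu_neq0 p0 am.
apply/translatorsP=> x xA; have := zA _ _ am (z'A _ _ (muV am) xA).
by rewrite (_ : a * _ + z = x + (a - 1) * (z' - z)) //; field.
Qed.

(** Conjugating a translation by a rotation multiplies the translation vector
    by a. *)
Lemma mu_translators p A (a b z : F) : (0 < p)%N -> a \in mu F p ->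
  z \in rotcentres p A -> b \in translators A -> a * b \in translators A.
Proof.
move=> p0 am /rotcentresP zA /translatorsP bA; have a0 := mu_neq0 p0 am.
apply/translatorsP=> x xA; have := zA _ _ am (bA _ (zA _ _ (muV am) xA)).
by rewrite (_ : a * _ + z = x + a * b) //; field.
Qed.

Lemma mu_nontrivial p : (1 < #|mu F p|)%N -> exists2 a, a \in mu F p & a != 1.
Proof.
rewrite (cardsD1 1) mu1 ltnS => /card_gt0P[a]; rewrite !inE => /andP[a1 am].
by exists a; rewrite ?inE.
Qed.

Lemma rotcentre_unique p A (z z' : F) : (0 < p)%N -> (1 < #|mu F p|)%N ->
    translators A = [set 0] ->
  z \in rotcentres p A -> z' \in rotcentres p A -> z = z'.
Proof.
move=> p0 /mu_nontrivial[a am a1] T0 zA z'A.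
have := rotcentres_diff p0 am zA z'A; rewrite T0 inE mulf_eq0 !subr_eq0 (negPf a1).
by move/eqP.
Qed.

Lemma card_rotcentres_le1 p A : (0 < p)%N -> (1 < #|mu F p|)%N ->
    translators A = [set 0] -> #|rotcentres p A| = (rotcentres p A != set0).
Proof.
move=> p0 m1 T0; case: eqVneq => [->|/set0Pn[z zA]]; first by rewrite cards0.
apply/eqP/cards1P; exists z; apply/setP=> z'; rewrite in_set1.
by apply/idP/eqP=> [/(rotcentre_unique p0 m1 T0 zA) //|->].
Qed.

Lemma card_translators_rotated p A : (0 < p)%N -> rotcentres p A != set0 ->
  translators A != [set 0] -> (#|mu F p| < #|translators A|)%N.
Proof.
move=> p0 /set0Pn[z zA] /translatedP[b b0 bA].
rewrite [leqRHS](cardsD1 0) translators0 ltnS.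
rewrite -(card_imset _ (mulIf b0)); apply: subset_leq_card.
apply/subsetP=> _ /imsetP[a am ->]; rewrite in_setD1 mulf_neq0 ?(mu_neq0 p0 am) //=.
exact: mu_translators am zA bA.
Qed.

Definition shift (z : F) A : {set F} := [set x + z | x in A].

Lemma mem_shift (z x : F) A : (x + z \in shift z A) = (x \in A).
Proof.
by apply/imsetP/idP=> [[y yA /addIr -> //]|xA]; exists x.
Qed.

Lemma card_shift (z : F) A : #|shift z A| = #|A|.
Proof. by rewrite card_imset //; apply: addIr. Qed.

Lemma shiftK (z : F) : cancel (shift z) (shift (- z)).
Proof.
move=> A; rewrite /shift -imset_comp -[RHS]imset_id; apply: eq_imset => x /=.
by rewrite addrK.
Qed.

Lemma translators_shift (z : F) A : translators (shift z A) = translators A.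
Proof.
apply/setP=> b; apply/translatorsP/translatorsP=> bA x.
  by rewrite -(mem_shift z) => /bA; rewrite addrAC mem_shift.
by case/imsetP=> y yA ->; rewrite addrAC mem_shift bA.
Qed.

Lemma rotcentres_shift p (z z' : F) A :
  (z' + z \in rotcentres p (shift z A)) = (z' \in rotcentres p A).
Proof.
apply/rotcentresP/rotcentresP=> H a x am.
  rewrite -(mem_shift z) => /(H a _ am).
  by rewrite (_ : _ + _ = a * (x - z') + z' + z) ?mem_shift //; ring.
case/imsetP=> y yA ->.
by rewrite (_ : _ + _ = a * (y - z') + z' + z) ?mem_shift ?H //; ring.
Qed.

(** Translations move any centre to 0 without changing the group of
    translations. *)
Lemma sum_rotcentres p (P : pred {set F}) :
  (\sum_(A in sets12 F | P (translators A)) #|rotcentres p A| =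
   2 ^ n * #|[set A in sets12 F | P (translators A) && (0%R \in rotcentres p A)]|)%N.
Proof.
transitivity (\sum_(A in sets12 F | P (translators A)) \sum_(z : F) (z \in rotcentres p A))%N.
  apply: eq_bigr => A _; rewrite -sum1_card [LHS]big_mkcond.
  by apply: eq_bigr => z _; case: (z \in _).
rewrite exchange_big /= -cardF -sum_nat_const; apply: eq_bigr => z _.
have -> : (\sum_(A in sets12 F | P (translators A)) (z \in rotcentres p A) =
    #|[set A in sets12 F | P (translators A) && (z \in rotcentres p A)]|)%N.
  rewrite -sum_bool big_mkcondr; apply: eq_bigr => A _.
  by case: (P _).
rewrite -[RHS](card_imset _ (can_inj (shiftK z))); apply: eq_card => A.
rewrite [LHS]inE; apply/idP/imsetP=> [/and3P[A12 PA zA]|[A' + ->]].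
  have AE : A = shift z (shift (- z) A).
    by have := shiftK (- z) A; rewrite opprK => ->.
  exists (shift (- z) A) => //; rewrite inE translators_shift PA.
  rewrite -(rotcentres_shift p z) -AE add0r zA !andbT.
  by rewrite inE card_shift; rewrite inE in A12.
rewrite inE translators_shift => /and3P[A12 -> zA].
have -> : z \in rotcentres p (shift z A') by rewrite -{1}[z]add0r rotcentres_shift.
by rewrite !andbT inE card_shift; rewrite inE in A12.
Qed.

Lemma card_mu_class p (x : F) : x != 0 -> #|[set a * x | a in mu F p]| = #|mu F p|.
Proof. by move=> x0; rewrite card_imset //; apply: mulIf. Qed.

Lemma mu_class_eq p (x y : F) : y \in [set a * x | a in mu F p] -> (0 < p)%N ->
  [set a * y | a in mu F p] = [set a * x | a in mu F p].
Proof.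
case/imsetP=> a am -> p0; have a0 := mu_neq0 p0 am.
apply/setP=> z; apply/imsetP/imsetP=> -[a' a'm ->].
  by exists (a' * a); rewrite ?mulrA // muM.
by exists (a' * a^-1); rewrite ?muM ?muV // mulrA divfK.
Qed.

(** The roots of unity act freely on the nonzero elements. *)
Lemma dvd_mu_closed p A : (0 < p)%N -> 0 \notin A ->
    (forall a x, a \in mu F p -> x \in A -> a * x \in A) ->
  (#|mu F p| %| #|A|)%N.
Proof.
move=> p0 A0 clA; have nz x : x \in A -> x != 0 by apply: contraTneq => ->.
rewrite (@card_classes _ A (fun x => [set a * x | a in mu F p]) #|mu F p|) ?dvdn_mull //.
- by move=> x xA; apply/imsetP; exists 1; rewrite ?mu1 ?mul1r.
- by move=> x xA; apply/subsetP=> _ /imsetP[a am ->]; apply: clA.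
- by move=> x y _ /mu_class_eq; apply.
- by move=> x /nz; apply: card_mu_class.
- by apply/card_gt0P; exists 1; apply: mu1.
Qed.

Lemma card_mu_closed p j : (0 < p)%N ->
  #|[set A : {set F} | [&& 0 \notin A, #|A| == (#|mu F p| * j)%N &
      [forall x in A, [set a * x | a in mu F p] \subset A]]]| =
  'C((2 ^ n).-1 %/ #|mu F p|, j).
Proof.
move=> p0; have nz x : x \in [set~ (0 : F)] -> x != 0 by rewrite in_setC1.
have <- : #|[set~ (0 : F)]| = (2 ^ n).-1 by rewrite cardsC1 cardF.
rewrite -(@card_unions_of_classes _ [set~ 0] (fun x => [set a * x | a in mu F p])).
- apply: eq_card => A; rewrite !inE; congr (_ && _).
  by rewrite subsetC sub1set inE.
- by move=> x xA; apply/imsetP; exists 1; rewrite ?mu1 ?mul1r.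
- move=> x /nz x0; apply/subsetP=> _ /imsetP[a am ->].
  by rewrite in_setC1 mulf_neq0 // (mu_neq0 p0 am).
- by move=> x y _ /mu_class_eq; apply.
- by move=> x /nz; apply: card_mu_class.
- by apply/card_gt0P; exists 1; apply: mu1.
Qed.

Lemma rotcentre0P p A : reflect (forall a x, a \in mu F p -> x \in A -> a * x \in A)
  (0 \in rotcentres p A).
Proof.
by apply: (iffP (rotcentresP _ _ _)) => H a x am /(H a x am); rewrite subr0 addr0.
Qed.

Lemma mu_closedP p A :
  (0 \in rotcentres p A) = [forall x in A, [set a * x | a in mu F p] \subset A].
Proof.
apply/rotcentre0P/forall_inP=> [H x xA|H a x am xA].
  by apply/subsetP=> _ /imsetP[a am ->]; apply: H.
by apply: (subsetP (H x xA)); apply: imset_f.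
Qed.

Lemma mu_closed_remove0 p A : (0 < p)%N ->
  (forall a x, a \in mu F p -> x \in A -> a * x \in A) ->
  (forall a x, a \in mu F p -> x \in A :\ 0 -> a * x \in A :\ 0).
Proof.
move=> p0 H a x am /setD1P[x0 xA]; apply/setD1P; split; last exact: H.
by rewrite mulf_neq0 // (mu_neq0 p0 am).
Qed.

(** A set of 12 points closed under the rotations of order 3 about 0 cannot
    contain 0, as 3 does not divide 11. *)
Lemma count_centre0_3 : #|mu F 3| = 3%N ->
  #|[set A in sets12 F | 0 \in rotcentres 3 A]| = 'C((2 ^ n).-1 %/ 3, 4).
Proof.
move=> m3; rewrite -[X in (_ %/ X)%N]m3 -card_mu_closed //; apply: eq_card => A.
rewrite [LHS]inE [RHS]inE [A \in _]inE -mu_closedP m3.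
apply/idP/idP=> [/andP[A12 A0]|/and3P[_ -> ->] //]; rewrite A0 A12 !andbT.
apply/negP=> zA; move/rotcentre0P: A0 => /(mu_closed_remove0 (isT : 0 < 3)%N).
move/(dvd_mu_closed (isT : 0 < 3)%N); rewrite !inE eqxx m3 => /(_ isT).
by have := cardsD1 0 A; rewrite zA (eqP A12) add1n => -[<-].
Qed.

(** Such a set consists of 0 and one coset of the group of 11th roots of
    unity. *)
Lemma count_centre0_11 : #|mu F 11| = 11%N ->
  #|[set A in sets12 F | 0 \in rotcentres 11 A]| = ((2 ^ n).-1 %/ 11)%N.
Proof.
move=> m11; rewrite -[RHS]bin1 -[X in (_ %/ X)%N]m11 -card_mu_closed // m11.
have finj : {in [set A : {set F} | [&& 0 \notin A, #|A| == (11 * 1)%N &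
      [forall x in A, [set a * x | a in mu F 11] \subset A]]] &,
   injective (fun A => 0 |: A)}.
  move=> A A'; rewrite !inE => /and3P[A0 _ _] /and3P[A'0 _ _] e.
  by rewrite -(setU1K A0) -(setU1K A'0) e.
rewrite -(card_in_imset finj); apply: eq_card => A.
rewrite [LHS]inE [A \in _]inE; apply/idP/imsetP=> [/andP[A12 A0]|[A' + ->]].
  move/rotcentre0P: A0 => clA; have clA' := mu_closed_remove0 (isT : 0 < 11)%N clA.
  have zA : 0 \in A.
    apply/negPn/negP=> zA; have := dvd_mu_closed (isT : 0 < 11)%N zA clA.
    by rewrite m11 (eqP A12).
  exists (A :\ 0); last by rewrite setD1K.
  rewrite inE -mu_closedP; apply/and3P; split; first by rewrite !inE eqxx.
    by have := cardsD1 0 A; rewrite zA (eqP A12) add1n => -[<-].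
  exact/rotcentre0P.
rewrite inE -mu_closedP => /and3P[A'0 A'11 /rotcentre0P clA'].
rewrite cardsU1 A'0 (eqP A'11) /=; apply/rotcentre0P=> a x am /setU1P[->|xA].
  by rewrite mulr0 setU11.
by rewrite setU1r // clA'.
Qed.

(** A rotation of order 11 excludes nontrivial translations, since it would
    give 11 of them; therefore the centre is unique. *)
Lemma card_rotated12_11 : #|mu F 11| = 11%N ->
  #|rotated12 F 11| = (2 ^ n * ((2 ^ n).-1 %/ 11))%N.
Proof.
move=> m11; rewrite -count_centre0_11 //.
have T0 A : A \in sets12 F -> rotcentres 11 A != set0 -> translators A = [set 0].
  rewrite inE => /eqP A12 RA; apply/eqP/negPn/negP=> TA.
  have := card_translators_rotated (isT : 0 < 11)%N RA TA; rewrite m11.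
  by have := card_translators cardF A12; rewrite !inE => /or3P[] /eqP ->.
have := sum_rotcentres 11 predT; rewrite /= => <-.
rewrite -sum_bool [RHS]big_mkcondr /=; apply: eq_bigr => A A12.
have [RA|] := boolP (rotcentres 11 A != set0); last by rewrite negbK => /eqP ->; rewrite cards0.
by rewrite card_rotcentres_le1 ?m11 ?T0 ?RA.
Qed.

Section Tetrahedral.
Hypothesis mu3 : #|mu F 3| = 3%N.
Variable b : F.
Hypothesis b0 : b != 0.

(** The one-dimensional GF(4)-subspace spanned by b: either x = 0 or (x / b)^3
    = 1. *)
Definition line4 : {set F} := [set x | x ^+ 4 == b ^+ 3 * x].

Lemma pow4D (x y : F) : (x + y) ^+ 4 = x ^+ 4 + y ^+ 4.
Proof.
have two0 : 2 = 0 :> F by rewrite -[2]/(1 + 1) (addrr_pchar2F cardF).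
transitivity (x ^+ 4 + y ^+ 4 + 2 * (2 * x ^+ 3 * y + 3 * x ^+ 2 * y ^+ 2 + 2 * x * y ^+ 3)).
  by ring.
by rewrite two0 mul0r addr0.
Qed.

Lemma line4D x y : x \in line4 -> y \in line4 -> x + y \in line4.
Proof. by rewrite !inE pow4D mulrDr => /eqP -> /eqP ->. Qed.

Lemma line4_mu a x : a \in mu F 3 -> (a * x \in line4) = (x \in line4).
Proof.
move=> am; have a0 := mu_neq0 (isT : 0 < 3)%N am; move/muP: am => a3.
rewrite !inE exprMn (_ : a ^+ 4 = a); last by rewrite exprS a3 mulr1.
by rewrite (_ : b ^+ 3 * (a * x) = a * (b ^+ 3 * x)) ?(inj_eq (mulfI a0)) //; ring.
Qed.

Lemma line4E : line4 = 0 |: [set a * b | a in mu F 3].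
Proof.
apply/setP=> x; rewrite !inE; have [->|x0] /= := eqVneq x 0.
  by rewrite mulr0 expr0n eqxx.
rewrite exprSr (inj_eq (mulIf x0)); apply/eqP/imsetP=> [x3|[a /muP a3 ->]].
  exists (x / b); last by rewrite divfK.
  by apply/muP; rewrite exprMn exprVn x3 divff // expf_neq0.
by rewrite exprMn a3 mul1r.
Qed.

Lemma card_line4 : #|line4| = 4%N.
Proof.
rewrite line4E cardsU1 card_mu_class // mu3.
by case: imsetP => // -[a am /esym/eqP]; rewrite mulf_eq0 (negPf b0) orbF
  (negPf (mu_neq0 (isT : 0 < 3)%N am)).
Qed.

(** The orbit of x under the group of order 12 generated by the rotations of
    order 3 about 0 and the translations by the elements of the line; this
    group is the alternating group on 4 letters. *)
Definition class12 (x : F) : {set F} :=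
  [set u.1 * x + u.2 | u in setX (mu F 3) line4].

Lemma line4_0 : 0 \in line4.
Proof. by rewrite inE mulr0 expr0n. Qed.

Lemma mem_class12 a l x : a \in mu F 3 -> l \in line4 -> a * x + l \in class12 x.
Proof. by move=> am lL; apply/imsetP; exists (a, l); rewrite // inE /= am. Qed.

Lemma class12_line x y : y \in class12 x -> (y \in line4) = (x \in line4).
Proof.
case/imsetP=> -[a l]; rewrite inE /= => /andP[am lL] ->.
rewrite -(line4_mu x am); apply/idP/idP=> h; last exact: line4D.
by rewrite -[a * x](addrK l) (subr_pchar2F cardF) line4D.
Qed.

Lemma class12_eq x y : y \in class12 x -> class12 y = class12 x.
Proof.
case/imsetP=> -[a l]; rewrite inE /= => /andP[am lL] ->.
have a0 := mu_neq0 (isT : 0 < 3)%N am.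
apply/setP=> z; apply/imsetP/imsetP=> -[[a' l']]; rewrite inE /= => /andP[a'm l'L] ->.
  exists (a' * a, a' * l + l'); last by rewrite /=; ring.
  by rewrite inE /= muM // line4D // line4_mu.
exists (a' / a, (a' / a) * l + l').
  by rewrite inE /= muM ?muV // line4D // line4_mu // muM ?muV.
rewrite /= mulrDr mulrA divfK // -addrA (addrA (_ * l)) (addrr_pchar2F cardF) add0r //.
Qed.

(** The group of order 12 acts freely outside the line. *)
Lemma card_class12 x : x \notin line4 -> #|class12 x| = 12%N.
Proof.
move=> xL; rewrite card_in_imset; first by rewrite cardsX mu3 card_line4.
move=> [a l] [a' l']; rewrite !in_setX /= => /andP[am lL] /andP[a'm l'L] e.
have ll : (a - a') * x = l' - l.
  transitivity (a * x + l - a' * x - l); first by ring.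
  by rewrite e; ring.
have [aa|aa] := eqVneq a a'.
  by move: ll; rewrite aa subrr mul0r => /esym/eqP; rewrite subr_eq0 => /eqP ->.
(* mu_3 together with 0 is a field, so a - a' is again a cube root of unity. *)
have daa : a - a' \in mu F 3.
  have d0 : a - a' != 0 by rewrite subr_eq0.
  apply/muP/(mulfI d0); rewrite mulr1 -exprS (subr_pchar2F cardF) pow4D !(exprS _ 3).
  by rewrite (muP _ _ am) (muP _ _ a'm) !mulr1.
case/negP: xL; rewrite -(line4_mu x daa) ll (subr_pchar2F cardF).
exact: line4D.
Qed.

Lemma line4_translators A : 0 \in rotcentres 3 A -> b \in translators A ->
  line4 \subset translators A.
Proof.
move=> zA bA; rewrite line4E subUset sub1set translators0 /=.
by apply/subsetP=> _ /imsetP[a am ->]; apply: mu_translators zA bA.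
Qed.

(** Such a set is a single free orbit of the group of order 12: it cannot meet
    the line, for then it would contain its 4 points and 12 would divide the
    remaining 8. *)
Lemma count_centre0_translated :
  #|[set A in sets12 F | (0 \in rotcentres 3 A) && (b \in translators A)]| =
  ((2 ^ n - 4) %/ 12)%N.
Proof.
rewrite -[RHS]bin1; have <- : #|~: line4| = (2 ^ n - 4)%N.
  by rewrite cardsCs setCK card_line4 cardF.
have cS x : x \in ~: line4 -> x \notin line4 by rewrite inE.
rewrite -(@card_unions_of_classes _ (~: line4) class12 12) //.
- apply: eq_card => A; rewrite [LHS]inE [RHS]inE [A \in _]inE muln1.
  apply/and3P/and3P=> [[A12 zA bA]|[AL A12 /forall_inP clA]].
    have LA := line4_translators zA bA.
    have cl x : x \in A -> class12 x \subset A.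
      move=> xA; apply/subsetP=> y /imsetP[[a l]]; rewrite in_setX /= => /andP[am lL] ->.
      have /translatorsP := subsetP LA _ lL; apply.
      by move/rotcentre0P: zA; apply.
    split=> //; last by apply/forall_inP.
    apply/subsetP=> x xA; rewrite in_setC; apply/negP=> xL.
    have sLA : line4 \subset A.
      apply/subsetP=> l lL; have /translatorsP := subsetP LA _ (line4D xL lL).
      by move/(_ x xA); rewrite addrA (addrr_pchar2F cardF) add0r.
    have : (12 %| #|A :\: line4|)%N.
      rewrite (@card_classes _ (A :\: line4) class12 12) ?dvdn_mull //.
      - by move=> y _; rewrite -[X in X \in _](addr0 y) -{1}(mul1r y) mem_class12 ?mu1 ?line4_0.
      - move=> y /setDP[yA yL]; apply/subsetP=> z zy.
        by rewrite inE (class12_line zy) yL (subsetP (cl _ yA)).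
      - by move=> y z _; apply: class12_eq.
      - by move=> y /setDP[_]; apply: card_class12.
    by rewrite cardsD (setIidPr sLA) card_line4 (eqP A12).
  have clx x u : x \in A -> u \in mu F 3 -> u * x \in A.
    move=> xA um; apply: (subsetP (clA x xA)).
    by rewrite -[u * x]addr0 mem_class12 ?line4_0.
  split=> //; first by apply/rotcentre0P=> a x am xA; apply: clx.
  apply/translatorsP=> x xA; apply: (subsetP (clA x xA)).
  rewrite -{1}[x]mul1r mem_class12 ?mu1 //.
  by rewrite line4E setU1r //; apply/imsetP; exists 1; rewrite ?mu1 ?mul1r.
- by move=> y _; rewrite -[X in X \in _](addr0 y) -{1}(mul1r y) mem_class12 ?mu1 ?line4_0.
- move=> y yL; apply/subsetP=> z zy; rewrite in_setC (class12_line zy); exact: cS.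
- by move=> y z _; apply: class12_eq.
- by move=> y /cS; apply: card_class12.
Qed.
End Tetrahedral.

(** Double count of the pairs (set, nonzero translation): in the presence of a
    rotation of order 3, a nontrivial group of translations has order 4. *)
Lemma count_centre0_both : #|mu F 3| = 3%N ->
  (3 * #|[set A in sets12 F | (translators A != [set 0%R]) && (0%R \in rotcentres 3 A)]| =
   (2 ^ n).-1 * ((2 ^ n - 4) %/ 12))%N.
Proof.
move=> m3.
transitivity (\sum_(b in [set~ (0%R : F)]) \sum_(A in sets12 F)
    ((0%R \in rotcentres 3 A) && (b \in translators A)))%N; last first.
  rewrite (eq_bigr (fun=> (2 ^ n - 4) %/ 12)%N) => [|b]; last first.
    by rewrite in_setC1 => b0; rewrite sum_bool count_centre0_translated.
  by rewrite sum_nat_const cardsC1 cardF.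
rewrite exchange_big /= -sum_bool big_distrr; apply: eq_bigr => A A12 /=.
have [zA|zA] := boolP (0 \in rotcentres 3 A); last first.
  by rewrite andbF muln0 big1.
rewrite sum_bool andbT.
rewrite (_ : [set b in _ | _] = translators A :\ 0); last first.
  by apply/setP=> b; rewrite [LHS]inE in_setC1 in_setD1.
have := cardsD1 0 (translators A); rewrite translators0 add1n.
have RA : rotcentres 3 A != set0 by apply/set0Pn; exists 0.
have [T1 _] := translatorsE cardF A12; have := card_translators_rotated (isT : 0 < 3)%N RA.
rewrite T1 m3; have := A12; rewrite inE => /eqP/(card_translators cardF).
move: (#|translators A|) (#|_ :\ 0|) => t s.
by rewrite !inE => /or3P[] /eqP -> // H [<-] //; have := H isT.
Qed.

(** The sets without translations have at most one centre; they are counted by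
    their centre, all sets with that centre being reduced by those that also
    have translations. *)
Lemma card_translated_or_rotated12 : #|mu F 3| = 3%N ->
  (3 * #|translated12 F :|: rotated12 F 3| + 2 ^ n * ((2 ^ n).-1 * ((2 ^ n - 4) %/ 12)) =
   3 * #|translated12 F| + 3 * 2 ^ n * 'C((2 ^ n).-1 %/ 3, 4))%N.
Proof.
move=> m3; rewrite -count_centre0_both // -count_centre0_3 //.
have -> : #|translated12 F :|: rotated12 F 3| = (#|translated12 F| +
   2 ^ n * #|[set A in sets12 F | (translators A == [set 0%R]) && (0%R \in rotcentres 3 A)]|)%N.
  rewrite -(@sum_rotcentres 3 (pred1 [set 0])) -(cardsID (translated12 F)).
  rewrite setUK; congr (_ + _)%N.
  rewrite setDUl setDv set0U.
  transitivity #|[set A in sets12 F | (translators A == [set 0]) && (rotcentres 3 A != set0)]|.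
    apply: eq_card => A; rewrite in_setD [A \in rotated12 _ _]inE [A \in translated12 _]inE.
    by rewrite [RHS]inE; case: (A \in _) => //=; rewrite negbK.
  rewrite -sum_bool [RHS]big_mkcondr; apply: eq_bigr => A A12 /=.
  case: (eqVneq (translators A) [set 0]) => //= T0.
  by rewrite card_rotcentres_le1 ?m3.
have -> : #|[set A in sets12 F | 0 \in rotcentres 3 A]| =
  (#|[set A in sets12 F | (translators A == [set 0%R]) && (0%R \in rotcentres 3 A)]| +
   #|[set A in sets12 F | (translators A != [set 0%R]) && (0%R \in rotcentres 3 A)]|)%N.
  rewrite -!sum_bool -big_split; apply: eq_bigr => A _ /=.
  by case: (translators A == _); case: (0 \in _).
by ring.
Qed.
End Rotated.

(** * Evaluation of the counts *)

(** It holds for k > N as well, since then one factor vanishes. *)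
Lemma natr_ffact (R : comPzRingType) (N k : nat) :
  (N ^_ k)%:R = \prod_(i < k) (N%:R - i%:R) :> R.
Proof.
elim: k => [|k IH]; first by rewrite big_ord0.
rewrite ffactnSr natrM IH big_ord_recr /=; have [kN|Nk] := leqP k N.
  by rewrite natrB.
by rewrite -IH ffact_small // !mul0r.
Qed.

Lemma natr_bin (N k : nat) (x f p : rat) : N%:R = x -> (k`!)%:R = f ->
  \prod_(i < k) (x - i%:R) = p -> 'C(N, k)%:R * f = p.
Proof. by move=> <- <- <-; rewrite -natrM bin_ffact natr_ffact. Qed.

Fixpoint decimal_value (R : pzRingType) (d : Decimal.uint) (r : R) : R :=
  match d with
  | Decimal.Nil => r
  | Decimal.D0 d => decimal_value d (10 * r)
  | Decimal.D1 d => decimal_value d (10 * r + 1%:R)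
  | Decimal.D2 d => decimal_value d (10 * r + 2)
  | Decimal.D3 d => decimal_value d (10 * r + 3)
  | Decimal.D4 d => decimal_value d (10 * r + 4)
  | Decimal.D5 d => decimal_value d (10 * r + 5)
  | Decimal.D6 d => decimal_value d (10 * r + 6)
  | Decimal.D7 d => decimal_value d (10 * r + 7)
  | Decimal.D8 d => decimal_value d (10 * r + 8)
  | Decimal.D9 d => decimal_value d (10 * r + 9)
  end.

Lemma tail_add_addn a b : Nat.tail_add a b = (a + b)%N.
Proof. by elim: a b => // a IH b; rewrite /= IH addnS. Qed.

Lemma tail_mul_muln a b : Nat.tail_mul a b = (a * b)%N.
Proof.
suff H r : Nat.tail_addmul r a b = (r + a * b)%N by rewrite /Nat.tail_mul H.
elim: a r => [|a IH] r /=; first by rewrite addn0.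
by rewrite IH tail_add_addn mulSn addnCA addnA.
Qed.

(** It makes the literals 6227020800 and 46080, which denote unary numbers,
    comparable with products of small ones. *)
Lemma natr_decimal (R : pzRingType) d acc :
  (Nat.of_uint_acc d acc)%:R = decimal_value d acc%:R :> R.
Proof.
by elim: d acc => [|d IH|d IH|d IH|d IH|d IH|d IH|d IH|d IH|d IH|d IH] acc //;
  cbn [Nat.of_uint_acc decimal_value]; rewrite IH tail_mul_muln;
  congr (decimal_value _ _); rewrite -natrM -?natrD; congr (_%:R); lia.
Qed.

Lemma natr_factorial13 : 6227020800%:R = (13`!)%:R :> rat.
Proof.
transitivity (decimal_value (Decimal.D6 (Decimal.D2 (Decimal.D2 (Decimal.D7
  (Decimal.D0 (Decimal.D2 (Decimal.D0 (Decimal.D8 (Decimal.D0 (Decimal.D0 Decimal.Nil)))))))))) 0 : rat).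
  exact: natr_decimal.
rewrite !factS fact0 !natrM.
cbn [decimal_value].
by ring.
Qed.

Lemma natr_46080 : 46080%:R = 64 * 720 :> rat.
Proof.
transitivity (decimal_value (Decimal.D4 (Decimal.D6 (Decimal.D0 (Decimal.D8
  (Decimal.D0 Decimal.Nil))))) 0 : rat); first exact: natr_decimal.
by cbn [decimal_value]; ring.
Qed.

(** The factorial is handed out as an opaque rational number d, so that no
    later step evaluates it in unary notation. *)
Lemma X1E (n : nat) : exists d : rat, [/\ d != 0, (13`!)%:R = d &
  X1 n = 1 / d *
  ((2 ^+ n - 2) * (2 ^+ n - 3) * (2 ^+ n - 4) * (2 ^+ n - 5) * (2 ^+ n - 6) *
   (2 ^+ n - 7) * (2 ^+ n - 8) * (2 ^+ n - 9) * (2 ^+ n - 10) * (2 ^+ n - 11))].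
Proof.
exists (13`!)%:R; split; [by rewrite pnatr_eq0 -lt0n fact_gt0 | by [] |].
exact: (congr1 (fun d : rat => 1 / d *
  ((2 ^+ n - 2) * (2 ^+ n - 3) * (2 ^+ n - 4) * (2 ^+ n - 5) * (2 ^+ n - 6) *
   (2 ^+ n - 7) * (2 ^+ n - 8) * (2 ^+ n - 9) * (2 ^+ n - 10) *
   (2 ^+ n - 11))) natr_factorial13).
Qed.

Lemma X2E (n : nat) : X2 n = 1 / (64 * 720) *
  ((2 ^+ n - 2) * (2 ^+ n - 4) * (2 ^+ n - 6) * (2 ^+ n - 8) * (2 ^+ n - 10)).
Proof.
exact: (congr1 (fun d : rat => 1 / d *
  ((2 ^+ n - 2) * (2 ^+ n - 4) * (2 ^+ n - 6) * (2 ^+ n - 8) *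
   (2 ^+ n - 10))) natr_46080).
Qed.

Lemma pow2_modn (d k n : nat) : (2 ^ k = 1 %[mod d] -> 2 ^ n = 2 ^ (n %% k) %[mod d])%N.
Proof.
move=> e; rewrite {1}(divn_eq n k) expnD mulnC [(_ * k)%N]mulnC expnM.
by rewrite -modnMmr -modnXm e modnXm exp1n modnMmr muln1.
Qed.

(** Powers of 2 have period k modulo d, so divisibility is decided by the
    exponents below k. *)
Lemma dvd_pow2_pred (d k n : nat) : (0 < k)%N -> (2 ^ k = 1 %[mod d])%N ->
    all (fun r => (d %| (2 ^ r).-1) == (r == 0))%N (iota 0 k) ->
  (d %| (2 ^ n).-1)%N = (k %| n)%N.
Proof.
move=> k0 e /allP H; have /H/eqP : (n %% k)%N \in iota 0 k by rewrite mem_iota ltn_pmod.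
have p0 r : (0 < 2 ^ r)%N by rewrite expn_gt0.
rewrite -!subn1 -!eqn_mod_dvd // /dvdn => <-.
by rewrite (pow2_modn n e).
Qed.

Lemma three_dvd n : (3 %| (2 ^ n).-1)%N = ~~ odd n.
Proof. by rewrite (@dvd_pow2_pred 3 2) // dvdn2. Qed.

Lemma eleven_dvd n : (11 %| (2 ^ n).-1)%N = (10 %| n)%N.
Proof. by rewrite (@dvd_pow2_pred 11 10). Qed.

(** For even n, 2^n - 4 = 4 (2^(n - 2) - 1), and 3 divides the second factor.
    *)
Lemma twelve_dvd n : (0 < n)%N -> ~~ odd n -> (12 %| 2 ^ n - 4)%N.
Proof.
move=> n0 ne; have n2 : (1 < n)%N by case: n n0 ne => [|[]].
have -> : (2 ^ n = 2 ^ (n - 2) * 4)%N by rewrite -(expnD 2 (n - 2) 2) subnK.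
rewrite -[X in (_ - X)%N]mul1n -mulnBl (_ : 12 = 3 * 4)%N //.
rewrite dvdn_pmul2r // subn1 three_dvd oddB // addbF //.
Qed.

Lemma four_dvd n : (1 < n)%N -> (2 ^ n %/ 4 * 4 = 2 ^ n)%N.
Proof. by move=> n2; rewrite divnK // (dvdn_exp2l 2 n2). Qed.

Lemma YE (n : nat) : Y n =
  - (1 / 1944%:R) * ((2 ^+ n - 1) * (2 ^+ n - 4) * (2 ^+ n - 16)).
Proof. exact: erefl. Qed.

Lemma X'E (n : nat) : X' n =
  X1 n - X2 n + 1 / 1152%:R * ((2 ^+ n - 2) * (2 ^+ n - 4) * (2 ^+ n - 8)).
Proof. exact: erefl. Qed.

Section Final.
Variables (n : nat) (F : finFieldType).
Hypothesis n_gt0 : (0 < n)%N.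
Hypothesis cardF : #|F| = (2 ^ n)%N.
Let Q : rat := 2 ^+ n.

Let QE : (2 ^ n)%:R = Q. Proof. exact: natrX. Qed.

Let QpE : (2 ^ n).+1%:R = Q + 1.
Proof. by have e : (2 ^ n)%:R + 1 = (2 ^ n).+1%:R :> rat := natr1 _; rewrite -e QE. Qed.

Let QmE : (2 ^ n).-1%:R = Q - 1.
Proof.
have q0 : (0 < 2 ^ n)%N by rewrite expn_gt0.
have e : (2 ^ n - 1)%:R = (2 ^ n)%:R - 1%:R :> rat := natrB _ q0.
by rewrite -subn1 e QE.
Qed.

Let natr_divn (d m : nat) : (0 < d)%N -> (d %| m)%N ->
  (m %/ d)%:R = m%:R / d%:R :> rat.
Proof.
move=> d0 dm; apply: (canRL (mulfK _)); first by rewrite pnatr_eq0 -lt0n.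
by rewrite -natrM divnK.
Qed.

Lemma bin_total : 'C((2 ^ n).+1, 13)%:R =
  (Q + 1) * Q * (Q - 1) * X1 n.
Proof.
have [d [d0 dE ->]] := X1E n; have := natr_bin QpE dE (erefl _); rewrite -/Q.
rewrite !big_ord_recr big_ord0 /= mul1r => e.
by apply: (mulIf d0); rewrite e; field.
Qed.

Lemma bin_translation : 'C(2 ^ n %/ 2, 6)%:R = Q * X2 n.
Proof.
have q2 : (2 ^ n %/ 2)%:R = Q / 2 by rewrite natr_divn ?QE // dvdn_exp.
have prodE : \prod_(i < 6) (Q / 2 - i%:R) =
    (Q / 2 - 0) * (Q / 2 - 1) * (Q / 2 - 2) * (Q / 2 - 3) * (Q / 2 - 4) * (Q / 2 - 5) :> rat.
  by rewrite !big_ord_recr big_ord0 /= mul1r.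
have factE : (6`!)%:R = 720 :> rat by rewrite !factS fact0 !natrM; ring.
have e := natr_bin q2 factE prodE.
rewrite X2E -/Q; apply: (@mulIf _ 720); first by rewrite pnatr_eq0.
by apply: (etrans e); field.
Qed.

(** The factor Q - 2 takes care of q = 2, which is not divisible by 4. *)
Lemma bin_klein : (Q - 2) * 'C(2 ^ n %/ 4, 3)%:R =
  (Q - 2) * (Q * (Q - 4) * (Q - 8) / 384).
Proof.
have [n1|n2] := leqP n 1.
  by rewrite (_ : Q = 2) ?subrr ?mul0r // /Q (_ : n = 1%N) //; apply/eqP; rewrite eqn_leq n1.
congr (_ * _).
have q4 : (2 ^ n %/ 4)%:R = Q / 4 by rewrite natr_divn ?QE // (dvdn_exp2l 2 n2).
have prodE : \prod_(i < 3) (Q / 4 - i%:R) =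
    (Q / 4 - 0) * (Q / 4 - 1) * (Q / 4 - 2) :> rat.
  by rewrite !big_ord_recr big_ord0 /= mul1r.
have factE : (3`!)%:R = 6 :> rat by rewrite !factS fact0 !natrM; ring.
have e := natr_bin q4 factE prodE.
apply: (@mulIf _ 6); first by rewrite pnatr_eq0.
by apply: (etrans e); field.
Qed.

Lemma bin_rotation : ~~ odd n -> 'C((2 ^ n).-1 %/ 3, 4)%:R =
  (Q - 1) * (Q - 4) * (Q - 7) * (Q - 10) / 1944.
Proof.
move=> ne; have q3 : ((2 ^ n).-1 %/ 3)%:R = (Q - 1) / 3.
  by rewrite natr_divn ?QmE // three_dvd.
have prodE : \prod_(i < 4) ((Q - 1) / 3 - i%:R) =
    ((Q - 1) / 3 - 0) * ((Q - 1) / 3 - 1) * ((Q - 1) / 3 - 2) * ((Q - 1) / 3 - 3) :> rat.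
  by rewrite !big_ord_recr big_ord0 /= mul1r.
have factE : (4`!)%:R = 24 :> rat by rewrite !factS fact0 !natrM; ring.
have e := natr_bin q3 factE prodE.
apply: (@mulIf _ 24); first by rewrite pnatr_eq0.
by apply: (etrans e); field.
Qed.

Lemma klein_translated12_value : #|klein_translated12 F|%:R =
  (Q - 1) * (Q - 2) * Q * (Q - 4) * (Q - 8) / 2304.
Proof.
have q2 : (2 ^ n - 2)%:R = Q - 2.
  by rewrite natrB ?QE // -{1}(expn1 2) leq_exp2l.
have cast (k t a b c : nat) : (k * t = a * b * c)%N ->
    k%:R * t%:R = a%:R * (b%:R * c%:R) :> rat.
  by move=> e; rewrite -!natrM e mulnA.
have := cast _ _ _ _ _ (count_translators2 cardF).
rewrite QmE q2 bin_klein => e.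
apply: (@mulfI _ 6); first by rewrite pnatr_eq0.
by apply: (etrans e); field.
Qed.

Lemma translated12_value : #|translated12 F|%:R =
  (Q - 1) * Q * X2 n - (Q - 1) * (Q - 2) * Q * (Q - 4) * (Q - 8) / 1152.
Proof.
have cast (t u a c : nat) : (t + 2 * u = a * c)%N ->
    t%:R = a%:R * c%:R - 2 * u%:R :> rat.
  by move=> e; rewrite -!natrM -e natrD addrK.
rewrite (cast _ _ _ _ (count_translators1 cardF)) QmE bin_translation klein_translated12_value.
by move: (X2 n) Q => x2 q; field.
Qed.

Lemma blocks_at_infty23_value : #|blocks_at_infty F (pred2 2%N 3%N)|%:R =
  (Q - 1) * Q * X2 n - (Q - 1) * (Q - 2) * Q * (Q - 4) * (Q - 8) / 1152
  - (if odd n then 0 else Q * (Q - 1) * Y n).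
Proof.
have := card_blocks_at_infty23 cardF => ->.
have [no|ne] := boolP (odd n).
  rewrite (mu_trivial cardF (isT : prime 3)) ?three_dvd ?no // eqxx setU0.
  by rewrite translated12_value subr0.
have m3 : #|mu F 3| = 3%N by rewrite (card_mu cardF) // three_dvd.
have -> : (mu F 3 == [set 1]) = false.
  by apply/negP=> /eqP m1; move: m3; rewrite m1 cards1.
have q4 : (2 ^ n - 4)%:R = Q - 4.
  rewrite natrB ?QE // -[X in (X <= _)%N]/(2 ^ 2)%N leq_exp2l //.
  by case: n n_gt0 ne => [|[]].
have q12 : ((2 ^ n - 4) %/ 12)%:R = (Q - 4) / 12.
  by rewrite natr_divn ?q4 // twelve_dvd.
have cast (w q a b t c : nat) : (3 * w + q * (a * b) = 3 * t + 3 * q * c)%N ->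
    w%:R = t%:R + q%:R * c%:R - q%:R * (a%:R * b%:R) / 3 :> rat.
  move=> e; have {}e : 3 * w%:R + q%:R * (a%:R * b%:R) =
      3 * t%:R + 3 * q%:R * c%:R :> rat by rewrite -!natrM -!natrD e.
  apply: (@mulfI _ 3); first by rewrite pnatr_eq0.
  by rewrite -(addrK (q%:R * (a%:R * b%:R)) (3 * w%:R)) e; field.
rewrite (cast _ _ _ _ _ _ (card_translated_or_rotated12 cardF m3)).
rewrite QE QmE q12.
rewrite (bin_rotation ne).
rewrite translated12_value.
rewrite YE -/Q.
by move: (X2 n) Q => x2 q; field.
Qed.

Lemma blocks_with_order11_value : #|blocks_with_order F 11|%:R =
  (if (10 %| n)%N then (Q + 1) * Q * (Q - 1) / 22 else 0).
Proof.
have cast (q z N : nat) : (q * z = 2 * N)%N -> N%:R = q%:R * z%:R / 2 :> rat.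
  by move=> e; rewrite -natrM e natrM mulrC mulKf.
rewrite (cast _ _ _ (census11 cardF)) QpE (card_blocks_at_infty11 cardF).
have [n10|n10] := boolP (10 %| n)%N; last first.
  rewrite (mu_trivial cardF (isT : prime 11)) ?eleven_dvd // eqxx cards0.
  by rewrite mulr0 mul0r.
have d11 : (11 %| (2 ^ n).-1)%N by rewrite eleven_dvd.
have m11 : #|mu F 11| = 11%N by rewrite (card_mu cardF).
have -> : (mu F 11 == [set 1]) = false.
  by apply/negP=> /eqP m1; move: m11; rewrite m1 cards1.
rewrite (card_rotated12_11 cardF m11) (natrM _ (2 ^ n)) natr_divn // QE QmE.
by field.
Qed.

Lemma blocks_with_order13_value : #|blocks_with_order F 13|%:R =
  (if (6 %| n)%N then (Q + 1) * Q * (Q - 1) / 26 else 0).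
Proof.
have cast (k N p q r s : nat) : (0 < k)%N -> (k * N = p * (q * r * s))%N ->
    N%:R = p%:R * (q%:R * r%:R * s%:R) / k%:R :> rat.
  move=> k0 e; rewrite -!natrM -e natrM mulrC mulKf //.
  by rewrite pnatr_eq0 -lt0n.
have e := census13 cardF; rewrite (card_order13_moving_infty cardF) in e.
rewrite (cast 156 _ _ _ _ _ isT e).
rewrite QpE QE QmE; case: ifP => _; first by field.
by rewrite !mulr0 mul0r.
Qed.

(** The two fractions are 10 N11 / |G| and 12 N13 / |G|, and Y is the
    contribution of the elements of order 3. *)
Lemma m1716_value : (m F 1716)%:R = X' n + (if odd n then 0 else Y n)
  + (if (10 %| n)%N then 5 / 11 else 0) + (if (6 %| n)%N then 6 / 13 else 0).
Proof.
have Q2 : 2 <= Q by rewrite /Q -{1}(expr1 2) ler_eXn2l // ltr1n.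
have Q0 : 0 < Q by apply: lt_le_trans Q2.
have G0 : (Q + 1) * (Q * (Q - 1)) != 0.
  rewrite !mulf_neq0 ?(gt_eqF Q0) ?subr_eq0 //.
    by rewrite gt_eqF // addr_gt0.
  by rewrite gt_eqF // (lt_le_trans _ Q2).
have cast (p q r w k N c N11 N13 : nat) :
    (k * (p * (q * r)) = N)%N -> (p * w + N = c + 10 * N11 + 12 * N13)%N ->
  k%:R * (p%:R * (q%:R * r%:R)) =
    c%:R + 10 * N11%:R + 12 * N13%:R - p%:R * w%:R :> rat.
  move=> eN e; rewrite -!natrM -!natrD -e -eN natrD.
  by rewrite [_ + _ - _]addrC addKr.
have := m1716_rigid cardF; rewrite (card_PSL2 cardF) => eN.
have := cast _ _ _ _ _ _ _ _ _ eN (census23 cardF).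
rewrite QpE QE QmE blocks_at_infty23_value blocks_with_order11_value blocks_with_order13_value bin_total => e.
apply: (mulIf G0); apply: (etrans e).
rewrite X'E -/Q.
move: (X1 n) (X2 n) (Y n) => x1 x2 y.
move: Q => q.
by case: (odd n); case: (10 %| n)%N; case: (6 %| n)%N; field.
Qed.
End Final.

(** Parity and divisibility by 10 and 6 depend only on the residue modulo 60,
    so a finite list of residues is checked by computation. *)
Lemma residue_conditions (n : nat) (s : seq nat) (o t d : bool) :
    all (fun r => [&& odd r == o, (10 %| r)%N == t & (6 %| r)%N == d]) s ->
    (n %% 60)%N \in s ->
  [/\ odd n = o, (10 %| n)%N = t & (6 %| n)%N = d].
Proof.
have dvdE k : (k %| 60)%N -> (k %| n)%N = (k %| n %% 60)%N.
  by move=> k60; rewrite /dvdn modn_dvdm.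
move=> /allP H /H /and3P[/eqP <- /eqP <- /eqP <-].
by rewrite !dvdE // -[odd n]negbK -dvdn2 dvdE // dvdn2 negbK.
Qed.

Theorem proposition5p25 (n : nat) (n_gt0 : (0 < n)%N)
    (F : finFieldType) (cardF : #|F| = (2 ^ n)%N) :
  [/\ odd n ->
        (m F 1716)%:R = X' n,
      (n %% 60)%N \in [:: 2; 4; 8; 14; 16; 22; 26; 28; 32; 34; 38; 44; 46; 52;
                          56; 58]%N ->
        (m F 1716)%:R = X' n + Y n,
      (n %% 60)%N \in [:: 10; 20; 40; 50]%N ->
        (m F 1716)%:R = X' n + Y n + 5 / 11,
      (n %% 60)%N \in [:: 6; 12; 18; 24; 36; 42; 48; 54]%N ->
        (m F 1716)%:R = X' n + Y n + 6 / 13 &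
      (n %% 60)%N \in [:: 0; 30]%N ->
        (m F 1716)%:R = X' n + Y n + 131%:R / 143%:R].
Proof.
rewrite (m1716_value n_gt0 cardF); move: (X' n) (Y n) => x y.
split=> [no|r|r|r|r].
- have n10 : (10 %| n)%N = false.
    by apply/negP=> /(dvdn_trans (isT : 2 %| 10)%N); rewrite dvdn2 no.
  have n6 : (6 %| n)%N = false.
    by apply/negP=> /(dvdn_trans (isT : 2 %| 6)%N); rewrite dvdn2 no.
  by rewrite no n10 n6 !addr0.
- by have [|-> -> ->] := @residue_conditions n _ false false false _ r; rewrite ?addr0.
- by have [|-> -> ->] := @residue_conditions n _ false true false _ r; rewrite ?addr0.
- by have [|-> -> ->] := @residue_conditions n _ false false true _ r; rewrite ?addr0.
- have [|-> -> ->] := @residue_conditions n _ false true true _ r; first by [].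
  by field.
Qed.
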